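(* Let $\mu\in(-1,1)$, $\mu\neq 0$, $\mu\neq-\frac12$, and let $\alpha\in[0,1)$, $\beta\ge 0$. Then the radius of $\beta$-uniform convexity of order $\alpha$, $r_{h_\mu}^{\beta-uc(\alpha)}$, of the function $h_\mu$ is the smallest positive root $r$ of the equation $$4(1-\alpha)-(1+\beta)\left(1+2\mu-2\sqrt r\,\frac{\left(\frac52-\mu\right)s_{\mu-\frac12,\frac12}'(\sqrt r)+\sqrt r\,s_{\mu-\frac12,\frac12}''(\sqrt r)}{\left(\frac32-\mu\right)s_{\mu-\frac12,\frac12}(\sqrt r)+\sqrt r\,s_{\mu-\frac12,\frac12}'(\sqrt r)}\right)=0.$$ Moreover, $r_{h_\mu}^{\beta-uc(\alpha)}<r_{h_\mu}^{c}<\delta_{\mu,1}<\xi_{\mu,1}$, where $\xi_{\mu,1}$ and $\delta_{\mu,1}$ denote the first positive zeros of $s_{\mu-\frac12,\frac12}$ and $h_\mu'$, respectively, and $r_{h_\mu}^{c}$ is the radius of convexity of $h_\mu$.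
   Context: Primes on functions denote derivatives. The Lommel function of the first kind is $$s_{\mu,\nu}(z)=\frac{z^{\mu+1}}{(\mu-\nu+1)(\mu+\nu+1)}\,{}_1F_2\left(1;\tfrac{\mu-\nu+3}{2},\tfrac{\mu+\nu+3}{2};-\tfrac{z^2}{4}\right),$$ so that $s_{\mu-\frac12,\frac12}(z)=\frac{z^{\mu+\frac12}}{\mu(\mu+1)}\,{}_1F_2\left(1;\frac{\mu+2}{2},\frac{\mu+3}{2};-\frac{z^2}{4}\right)$. The normalized function is $h_\mu(z)=\mu(\mu+1)z^{\frac{3-2\mu}{4}}s_{\mu-\frac12,\frac12}(\sqrt z)=z\,{}_1F_2\left(1;\frac{\mu+2}{2},\frac{\mu+3}{2};-\frac{z}{4}\right)$. For $f(z)=z+\sum_{n\ge2}a_nz^n$ with radius of convergence $r_f\in(0,\infty]$ and $U(r)=\{z\in\mathbb{C}:|z|<r\}$, the radius of convexity is $$r_f^{c}=\sup\left\{r\in(0,r_f):\Re\left(1+\frac{zf''(z)}{f'(z)}\right)>0,\ z\in U(r)\right\},$$ and for $\beta\ge0$, $\alpha\in[0,1)$ the radius of $\beta$-uniform convexity of order $\alpha$ is $$r_f^{\beta-uc(\alpha)}=\sup\left\{r\in(0,r_f):\Re\left(1+\frac{zf''(z)}{f'(z)}\right)>\beta\left|\frac{zf''(z)}{f'(z)}\right|+\alpha,\ z\in U(r)\right\}.$$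
   Formalization: The printed chain is false in two places: for α=β=0 the two radii coincide, so strict r^{β-uc(α)}<r^c is claimed only for (α,β)≠(0,0) and ≤ otherwise; and δ<ξ fails (near μ=0, δ≈4.12>ξ≈π), so it is replaced by δ<ξ², since ξ² is the zero of h_μ. *)

(* Defs.v *)
From HB Require Import structures.
From mathcomp Require Import all_boot all_order all_algebra.
From mathcomp Require Import all_classical all_reals all_analysis.
From mathcomp Require Export complex.

Set Implicit Arguments.
Unset Strict Implicit.
Unset Printing Implicit Defensive.

Import Order.TTheory GRing.Theory Num.Theory.
Import numFieldNormedType.Exports.

Local Open Scope classical_set_scope.
Local Open Scope ring_scope.
Local Open Scope complex_scope.

(* Complex-valued functions have codomain R[i]^o, the regular module, since
   this is the alias of R[i] that carries the normed-module structure used by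
   limits and derivatives. The derivative derive1 f of f : R[i] -> R[i]^o is the
   complex one: the increment ranges over the punctured neighbourhoods of 0 in
   R[i]. *)

Definition pochhammer (K : numFieldType) (a : K) (n : nat) : K :=
  \prod_(i < n) (a + i%:R).

Definition hyp1F2 (K : numFieldType) (a b c z : K) : K :=
  limn (series (fun n : nat =>
    pochhammer a n / (pochhammer b n * pochhammer c n) * z ^+ n / n`!%:R : K^o)).

(* Lommel function of the first kind, on the half-line x > 0 only (where the
   power x `^ (mu + 1) is the usual one). *)
Definition lommel_s (R : realType) (mu nu x : R) : R :=
  x `^ (mu + 1) / ((mu - nu + 1) * (mu + nu + 1))
    * hyp1F2 1 ((mu - nu + 3) / 2) ((mu + nu + 3) / 2) (- (x ^+ 2 / 4)).

Definition lommel_h (R : realType) (mu : R) (z : R[i]) : R[i]^o :=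
  z * hyp1F2 1 ((mu + 2) / 2)%:C ((mu + 3) / 2)%:C (- (z / 4)).

Section radii.
Variable R : realType.
Implicit Types f : R[i] -> R[i]^o.

Definition taylor_coef f (n : nat) : R[i] := derive1n n f 0 / n`!%:R.

Definition conv_radius f : \bar R :=
  ereal_sup [set r%:E | r in [set r : R | 0 <= r /\
    cvgn (series (fun n : nat => Normc.normc (taylor_coef f n) * r ^+ n))]].

Definition zf''_f' f (z : R[i]) : R[i] := z * derive1n 2 f z / derive1 f z.

(* In the two radii below, the condition derive1 f z != 0 makes explicit that the
   quotient is defined (division by zero yields 0 here). *)
Definition convexity_radius f : \bar R :=
  ereal_sup [set r%:E | r in [set r : R |
    [/\ 0 < r, (r%:E < conv_radius f)%E &
        forall z, Normc.normc z < r ->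
          derive1 f z != 0 /\ 0 < complex.Re (1 + zf''_f' f z)]]].

Definition uniform_convexity_radius (beta alpha : R) f : \bar R :=
  ereal_sup [set r%:E | r in [set r : R |
    [/\ 0 < r, (r%:E < conv_radius f)%E &
        forall z, Normc.normc z < r ->
          derive1 f z != 0 /\
          beta * Normc.normc (zf''_f' f z) + alpha
            < complex.Re (1 + zf''_f' f z)]]].

End radii.

Definition is_smallest_pos (R : realType) (P : set R) (x : R) : Prop :=
  [/\ 0 < x, P x & forall y, 0 < y -> P y -> x <= y].

(* D != 0 is part of the equation, again because of x / 0 = 0. *)
Definition uc_equation (R : realType) (mu alpha beta r : R) : Prop :=
  let s := lommel_s (mu - 2^-1) 2^-1 in
  let x := Num.sqrt r in
  let D := (3 / 2 - mu) * s x + x * derive1 s x in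
  D != 0 /\
  4 * (1 - alpha) - (1 + beta) *
    (1 + 2 * mu - 2 * x * (((5 / 2 - mu) * derive1 s x + x * derive1n 2 s x) / D)) = 0.

(* Main.v *)
Require Import Defs.
From mathcomp Require Import all_boot all_order all_algebra.
From mathcomp Require Import all_classical all_reals all_analysis.
From mathcomp Require Import ring lra zify.
Import Order.TTheory GRing.Theory Num.Theory.
Import numFieldNormedType.Exports.
Import Normc.
Local Open Scope classical_set_scope.
Local Open Scope ring_scope.
Local Open Scope complex_scope.

Set Implicit Arguments.
Unset Strict Implicit.

(** Write a = mu + 2, F(z) = sum_n (-z)^n / (a)_(2n) and g = h', where
    h(z) = z F(z) is the normalized Lommel function; also
    s(x) = x^(mu + 1/2) F(x^2) / (mu (mu + 1)).

    The radii are governed by one fact: the Taylor coefficients at 0 of the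
    logarithmic derivative -g'/g are nonnegative.  Hence, as long as the series
    S of -g'/g converges, |z h''(z) / h'(z)| = |z g'(z) / g(z)| <= r S(r) for
    |z| = r, with equality at z = r, where z g'/g = - r S(r) is real.  So
      Re (1 + z g'/g) - beta |z g'/g| - alpha >= 1 - alpha - (1 + beta) r S(r),
    again with equality at z = r, and the radius of beta-uniform convexity of
    order alpha is the first zero of 1 - alpha - (1 + beta) r S(r), that is, of
      (1 - alpha) g(r) + (1 + beta) r g'(r).
    Expressing g and g' through s, s' and s'' turns this into the equation of
    the theorem ([uc_equationE]).  The radius of convexity is the case
    alpha = beta = 0, and the two radii compare because the second expression
    equals - (alpha + beta) g(rc) at the radius of convexity rc.

    The nonnegativity is usually read off a Hadamard product, g having only
    positive zeros.  Here it is proved from the recurrence that the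
    coefficients of -g'/g satisfy ([log_derivative_ge0]); the coefficients of g
    are dominated, ratio by ratio and after scaling z by a (a + 1), by those of
    the extreme case a = 3, where g(z) = sin (sqrt z) / sqrt z.  The same recurrence bounds
    the coefficients by a geometric sequence, so that S converges for
    |z| < a (a + 1) / 2.
    This disk is large enough: at Z0 = 39/100 a (a + 1) the function
    g + t g' is negative ([convexity_equation_neg]), so all the radii are
    smaller than Z0, while g has no zero with |z| <= Z0 ([dlommel_neq0]), so
    the first zero delta of g is larger.

    It remains to see that F(x^2) has a positive zero xi; Rolle's theorem for h
    on [0, xi^2] then gives delta < xi^2.  The function y = x^(a-1) F(x^2)
    solves y'' + y = (a - 1) (a - 2) x^(a-3), so the Wronskian of y and sin has
    derivative (a - 1) (a - 2) x^(a-3) sin x; a Sturm comparison on (0, pi] or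
    (0, 2 pi], according to the sign of a - 2, gives y <= 0 at the right end
    ([lommel_nonpos]). *)

(** * Coefficients of a logarithmic derivative *)

(** Division of formal power series: the product of the series c and T is b.
    The values of T are built as a list, most recent first, so that the
    convolution becomes a sum along the list. *)
Lemma series_quotient_exists (K : pzRingType) (c b : nat -> K) : c 0%N = 1 ->
  exists T : nat -> K, forall k, \sum_(i < k.+1) c i * T (k - i)%N = b k.
Proof.
move=> c0.
pose L := fix L k := if k is k'.+1
  then (b k' - \sum_(i < k') c i.+1 * (L k')`_i) :: L k' else [::] : seq K.
have LT k i : (i < k)%N -> (L k)`_i = head 0 (L (k - i)%N).
  elim: k i => // k IH [|i] //= ik; exact: IH.
exists (fun k => head 0 (L k.+1)) => k.
rewrite big_ord_recl c0 mul1r subn0 [head _ _]/=.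
rewrite -[RHS](subrK (\sum_(i < k) c i.+1 * (L k)`_i)).
congr (_ + _); apply: eq_bigr => i _.
by rewrite LT // -(subnSK (ltn_ord i)) lift0.
Qed.

Lemma alternating_sum_bounds (R : numDomainType) (u : nat -> R) m :
  (forall i, (i <= m)%N -> 0 <= u i) ->
  (forall i, (i < m)%N -> u i.+1 <= u i) ->
  0 <= \sum_(i < m.+1) (-1) ^+ i * u i <= u 0%N.
Proof.
elim: m u => [|m IH] u u0 ud.
  by rewrite big_ord_recl big_ord0 expr0 mul1r addr0 u0 ?lexx.
have /andP[S0 S1] := IH (fun i => u i.+1) (fun i im => u0 i.+1 im) (fun i im => ud i.+1 im).
rewrite big_ord_recl expr0 mul1r.
have -> : \sum_(i < m.+1) (-1) ^+ lift ord0 i * u (lift ord0 i) =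
          - \sum_(i < m.+1) (-1) ^+ i * u i.+1.
  by rewrite -sumrN; apply: eq_bigr => i _; rewrite lift0 exprS mulN1r mulNr.
by rewrite subr_ge0 gerBl S0 (le_trans S1) ?ud.
Qed.

(** Put G(w) = sum_n (-1)^n A_n w^n.  The recurrence [T_rec] says that T lists
    the coefficients of -G'/G.  The bound [A_ratio] is an equality when
    G(w) = sin x / x with w = x^2 / 12; it makes A decrease fast enough for the
    alternating sums below to be controlled by their first terms. *)
Section LogDerivative.
Variables (R : realFieldType) (A T : nat -> R).
Hypothesis A0 : A 0%N = 1.
Hypothesis A1 : A 1%N = 2.
Hypothesis A_ge0 : forall n, 0 <= A n.
Hypothesis A_ratio : forall n, (n.+1 * (2 * n + 3))%:R * A n.+1 <= 6 * A n.

(** The conditions [A23] and [A234] say that T_1 <= T_2 and T_2 <= T_3; for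
    G = sin x / x they are strict, but T_0 <= T_1 fails. *)
Hypothesis A23 : 0 <= 4 * (1 - A 2%N) + 3 * A 3%N.
Hypothesis A234 :
  0 <= 8 - 10 * A 2%N + 2 * A 2%N ^+ 2 + 5 * A 3%N - 4 * A 4%N.
Hypothesis T_rec : forall k,
  \sum_(i < k.+1) ((-1) ^+ i * A i) * T (k - i)%N = (-1) ^+ k * (k.+1%:R * A k.+1).

Let T_recE k : T k =
  \sum_(i < k) (-1) ^+ i * (A i.+1 * T (k - i.+1)%N) + (-1) ^+ k * (k.+1%:R * A k.+1).
Proof.
rewrite -T_rec big_ord_recl /= A0 mulr1 mul1r subn0 addrCA -[LHS]addr0; congr (_ + _).
rewrite -big_split big1 //= => i _.
by rewrite /bump /= add1n exprS; ring.
Qed.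

Let T0 : T 0%N = 2.
Proof. by rewrite T_recE big_ord0 A1; ring. Qed.

Let T1 : T 1%N = 4 - 2 * A 2%N.
Proof. by rewrite T_recE big_ord_recl big_ord0 /= A1 T0; ring. Qed.

Let T2 : T 2%N = 8 - 6 * A 2%N + 3 * A 3%N.
Proof. by rewrite T_recE !big_ord_recl big_ord0 /= A1 /bump /= T0 T1; ring. Qed.

Let T3 : T 3%N = 2 * T 2%N - A 2%N * T 1%N + 2 * A 3%N - 4 * A 4%N.
Proof. by rewrite T_recE !big_ord_recl big_ord0 /= A1 /bump /= T0; ring. Qed.

Let A2_le : A 2%N <= 6 / 5.
Proof. have := A_ratio 1; rewrite A1 /=; lra. Qed.

Let A_ratio_nat n (a b : nat) : (b * 6 <= a * (n.+1 * (2 * n + 3)))%N ->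
  b%:R * A n.+1 <= a%:R * A n.
Proof.
move=> h; have := A_ratio n; have := A_ge0 n.+1.
rewrite -(ler_nat R) !natrM in h *.
move: (n.+1%:R * _ : R) h => x h A0n hx.
have a0 : 0 <= a%:R :> R by [].
suff : 6 * (b%:R * A n.+1) <= 6 * (a%:R * A n) by lra.
apply: (@le_trans _ _ (a%:R * (x * A n.+1))); last first.
  by rewrite [leRHS]mulrCA ler_wpM2l.
by rewrite !mulrA ler_wpM2r // mulrC.
Qed.

(** Up to sign, the coefficients of (1 + w/3) G(w) in positive degree. *)
Let d n : R := A n.-1 / 3 - A n.

(** The recurrence of T added to a third of the preceding instance, which
    amounts to writing -G'/G as (1 + w/3) (-G') over (1 + w/3) G.  The
    multiplier moves weight onto the first terms: the recurrence [T_recE] alone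
    is too lossy to compare two consecutive values of T, because its term
    A_3 T_(k-3) would have to be bounded below in terms of T_(k-2). *)
Let T_rec_third k : (0 < k)%N -> T k = 5 / 3 * T k.-1 +
  \sum_(i < k.-1) (-1) ^+ i * (d i.+2 * T (k - i.+2)%N) +
  (-1) ^+ k.-1 * (k%:R * A k / 3 - k.+1%:R * A k.+1).
Proof.
case: k => // k _ /=.
have := T_recE k; rewrite [in X in X -> _](T_recE k) => _.
have e1 := T_recE k.+1; have e2 := T_recE k.
rewrite big_ord_recl /= in e1.
suff : T k.+1 + T k / 3 = 2 * T k + \sum_(i < k) (-1) ^+ i * (d i.+2 * T (k.+1 - i.+2)%N) +
  (-1) ^+ k * (k.+1%:R * A k.+1 / 3 - k.+2%:R * A k.+2) by lra.
rewrite e1 {1}e2 {e1 e2} A1 subSS subn0 expr0 mul1r.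
have -> : \sum_(i < k) (-1) ^+ i * (d i.+2 * T (k.+1 - i.+2)%N) =
  \sum_(i < k) (-1) ^+ bump 0 i * (A (bump 0 i).+1 * T (k.+1 - (bump 0 i).+1)%N)
  + (\sum_(i < k) (-1) ^+ i * (A i.+1 * T (k - i.+1)%N)) / 3.
  rewrite mulr_suml -big_split; apply: eq_bigr => i _ /=.
  by rewrite /d /bump /= add1n subSS exprS; ring.
by rewrite exprS; ring.
Qed.

(** In the combined recurrence for T_(m+4), the terms of index at least 4 form
    an alternating sum with nonincreasing absolute values starting with a
    positive term, so they may be dropped.  What remains is a combination of
    T_(m+3) >= T_(m+2) >= T_(m+1) >= 0 which is at least T_(m+3) because
    4/3 (1 - A_2) + A_3 >= 0. *)
Let T_step m :
  (forall j, (j < m.+2)%N -> T j.+1 <= T j.+2) -> T m.+3 <= T m.+4.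
Proof.
move=> IH.
have T1_ge0 : 0 <= T 1%N by rewrite T1; have := A2_le; lra.
have TS_ge0 j : (j <= m.+2)%N -> 0 <= T j.+1.
  by elim: j => // j IHj jm; rewrite (le_trans (IHj _)) ?IH // ltnW.
have T_quarter j : (j < m.+2)%N -> T j <= 5 / 4 * T j.+1.
  case: j => [_|j jm]; first by rewrite T0 T1; have := A2_le; lra.
  have := IH j (ltnW jm); have := TS_ge0 j.+1 (ltnW jm); lra.
have T_ge0 j : (j <= m.+2)%N -> 0 <= T j.
  case: j => [_|j jm]; [by rewrite T0 | exact/TS_ge0/ltnW].
pose k := m.+4.
(* Absolute values of the terms of index i + 4, the last one coming from the
   right-hand side of the recurrence. *)
pose u i := if (i <= m)%N then d i.+4 * T (m - i)%N
  else k%:R * A k / 3 - k.+1%:R * A k.+1.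
have d_ge0 n : (3 <= n)%N -> 0 <= d n.+1.
  by move=> n3; have := @A_ratio_nat n 1 3 ltac:(nia); rewrite /d /=; lra.
have dS n : (3 <= n)%N -> 5 / 4 * d n.+2 <= d n.+1.
  move=> n3; have := @A_ratio_nat n 4 17 ltac:(nia); have := A_ge0 n.+2; rewrite /d /=; lra.
have eqk : k = m.+3.+1 by [].
have tail : 0 <= \sum_(i < m.+2) (-1) ^+ i * u i.
  suff /andP[] : 0 <= \sum_(i < m.+2) (-1) ^+ i * u i <= u 0%N by [].
  apply: alternating_sum_bounds.
  - move=> i im; rewrite /u; case: leqP => [im'|_].
      by rewrite mulr_ge0 ?d_ge0 ?T_ge0 // (leq_trans (leq_subr _ _)) // ltnW.
    have := @A_ratio_nat k k (3 * k.+1) ltac:(rewrite eqk; nia).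
    rewrite natrM; lra.
  move=> i; rewrite ltnS => im; rewrite /u im; case: (ltnP i m) => [im'|mi].
        have -> : (m - i = (m - i.+1).+1)%N by lia.
    have := T_quarter (m - i.+1)%N ltac:(lia); have := T_ge0 (m - i.+1)%N ltac:(lia).
    have := dS i.+3 isT; have := d_ge0 i.+4 isT.
    move: (d _) (d _) (T _) (T _) => x y s t; nra.
  have -> : i = m by lia.
  rewrite subnn T0 /d /=.
  have := @A_ratio_nat m.+3 2 (k + 6) ltac:(rewrite eqk; nia).
  have := A_ge0 k.+1; rewrite -eqk natrD => ? ?.
  have : 0 <= k.+1%:R * A k.+1 by rewrite mulr_ge0.
  lra.
have -> : T m.+4 = 5 / 3 * T m.+3 + d 2 * T m.+2 - d 3 * T m.+1 +
    \sum_(i < m.+2) (-1) ^+ i * u i.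
  rewrite (@T_rec_third m.+4) // 2!big_ord_recl [in RHS]big_ord_recr /=.
  rewrite /bump /= !subSS subn0 {2}/u ltnn.
  have -> : \sum_(i < m.+1) (-1) ^+ i * u i =
     \sum_(i < m.+1) (-1) ^+ (1 + (1 + i)) * (d (1 + (1 + i)).+2 * T (m.+2 - (1 + (1 + i)))%N).
    apply: eq_bigr => i _; rewrite /u -ltnS ltn_ord !add1n !subSS !exprS; ring.
  rewrite -/k !exprS; ring.
have := IH m.+1 (leqnn _); have := IH m (leqnSn _); have := T_ge0 m.+1 ltac:(lia).
move: tail; rewrite /d /= A1.
set S := \sum_(_ < _) _; move: (T _) (T _) (T _) => x y z hS.
have : 0 <= A 3%N by [].
move: (A 3%N) (A 2%N) A2_le A23 => a3 a2 ha2 h23 a30 hz hzy hyx.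
have : 0 <= (4 / 3 - a2) * (y - z) by rewrite mulr_ge0; lra.
have : 0 <= (4 / 3 * (1 - a2) + a3) * z by rewrite mulr_ge0; lra.
lra.
Qed.

Let T_mono k : T k.+1 <= T k.+2.
Proof.
elim/ltn_ind: k => -[|[|k]] IH.
- rewrite T1 T2; have := A23. lra.
- rewrite T3 T1 T2; have := A234. nra.
exact: T_step.
Qed.

Lemma log_derivative_ge0 k : 0 <= T k.
Proof.
case: k => [|k]; first by rewrite T0.
elim: k => [|k IH]; first by rewrite T1; have := A2_le; lra.
exact: le_trans (T_mono k).
Qed.

(** In [T_recE] the terms after the first again form an alternating sum with
    nonincreasing absolute values, so T_(k+1) <= A_1 T_k = 2 T_k. *)
Lemma log_derivative_le k : T k <= 2 ^+ k.+1.
Proof.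
elim: k => [|k IH]; first by rewrite T0; lra.
rewrite exprS; suff : T k.+1 <= 2 * T k by lra.
have Tq j : T j <= 5 / 4 * T j.+1.
  case: j => [|j]; first by rewrite T0 T1; have := A2_le; lra.
  have := T_mono j; have := log_derivative_ge0 j.+1; have := log_derivative_ge0 j.+2; lra.
pose u i := if (i < k)%N then A i.+2 * T (k - i.+1)%N else k.+2%:R * A k.+2.
suff h : T k.+1 = 2 * T k - \sum_(i < k.+1) (-1) ^+ i * u i.
  rewrite h lerBlDr lerDl.
  suff /andP[] : 0 <= \sum_(i < k.+1) (-1) ^+ i * u i <= u 0%N by [].
  apply: alternating_sum_bounds.
  - move=> i ik; rewrite /u; case: ltnP => _; rewrite mulr_ge0 ?log_derivative_ge0 //.
  move=> i ik; rewrite /u ik; case: (ltnP i.+1 k) => [ik'|ki].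
    have -> : (k - i.+1 = (k - i.+2).+1)%N by lia.
    have := Tq (k - i.+2)%N; have := log_derivative_ge0 (k - i.+2)%N.
    have := @A_ratio_nat i.+2 4 5 ltac:(nia); have := A_ge0 i.+3.
    move: (A _) (A _) (T _) (T _) => x y s t; nra.
  have -> : k = i.+1 by lia.
  by rewrite subnn T0 [leRHS]mulrC; apply: (@A_ratio_nat i.+2 2 i.+3); nia.
rewrite T_recE big_ord_recl /= [in RHS]big_ord_recr /= {2}/u ltnn A1 subSS subn0.
have -> : \sum_(i < k) (-1) ^+ i * u i = - \sum_(i < k) (-1) ^+ bump 0 i *
    (A (bump 0 i).+1 * T (k.+1 - (bump 0 i).+1)%N).
  rewrite -sumrN; apply: eq_bigr => i _.
  by rewrite /u ltn_ord /bump /= !add1n subSS exprS; ring.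
rewrite exprS; ring.
Qed.

End LogDerivative.

(** * Limits of complex sequences *)

Section ComplexLimits.
Variable R : realType.
Implicit Types (u : nat -> R[i]) (z l : R[i]).

Lemma normCE z : `|z| = (normc z)%:C.
Proof. by []. Qed.

Lemma normc_ge0 z : 0 <= normc z.
Proof. by rewrite -ler0c -normCE normr_ge0. Qed.

Lemma normcX z n : normc (z ^+ n) = normc z ^+ n.
Proof. by apply: complexI; rewrite rmorphXn /= -!normCE normrX. Qed.

Lemma normc_real (x : R) : normc x%:C = `|x|.
Proof. by rewrite /normc /= expr0n addr0 sqrtr_sqr. Qed.

Lemma normc_eq0 z : (normc z == 0) = (z == 0).
Proof. by apply/eqP/eqP => [/eq0_normc|->]; rewrite ?normc0. Qed.

Lemma normcB z l : normc (z - l) = normc (l - z).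
Proof. by apply: complexI; rewrite -!normCE distrC. Qed.

Lemma normc_triangle z l : normc (z + l) <= normc z + normc l.
Proof. by rewrite -lecR rmorphD /= -!normCE ler_normD. Qed.

Lemma normc_Re z : `|complex.Re z| <= normc z.
Proof. by rewrite -lecR -normCE; exact: normc_ge_Re. Qed.

Lemma normc_Im z : `|complex.Im z| <= normc z.
Proof.
by have := normc_Re (z * 'i%C); rewrite ReiNIm normrN normcM /= expr0n add0r expr1n sqrtr1 mulr1.
Qed.

Lemma normc_le_ReIm z : normc z <= `|complex.Re z| + `|complex.Im z|.
Proof.
rewrite {1}[z]complexE (le_trans (normc_triangle _ _)) // normc_real normcM normc_real.
by rewrite /= expr0n add0r expr1n sqrtr1 mul1r.
Qed.

Lemma normc_sum_le u n :
  normc (\sum_(0 <= i < n) u i) <= \sum_(0 <= i < n) normc (u i).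
Proof.
elim: n => [|n IH]; first by rewrite !big_geq // normc0.
by rewrite !big_nat_recr //= (le_trans (normc_triangle _ _)) // lerD2r.
Qed.

(** The norm of R[i] takes its values in R[i] itself; this restates convergence
    with the real-valued norm. *)
Lemma cvgnCP (u : nat -> R[i]^o) (l : R[i]^o) : u @ \oo --> l <->
  forall e : R, 0 < e -> \forall n \near \oo, normc (l - u n) < e.
Proof.
split=> [/cvgrPdist_lt ul e e0|ul].
  have e0C : (0 : R[i]) < e%:C by rewrite (ltcR 0).
  by apply: filterS (ul _ e0C) => n; rewrite normCE ltcR.
apply/cvgrPdist_lt => -[e e'].
rewrite ltcE /= => /andP[/eqP -> /= e0].
by apply: filterS (ul _ e0) => n; rewrite normCE -complexr0 ltcR.
Qed.

Lemma cvgnC_real (u : nat -> R) (l : R) :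
  u @ \oo --> l -> (fun n => (u n)%:C : R[i]^o) @ \oo --> (l%:C : R[i]^o).
Proof.
move=> /cvgrPdist_lt ul; apply/cvgnCP => e e0.
by apply: filterS (ul e e0) => n; rewrite -rmorphB normc_real.
Qed.

Lemma cvgnC_ReIm (u : nat -> R[i]^o) (a b : R) :
  complex.Re (u n) @[n --> \oo] --> a -> complex.Im (u n) @[n --> \oo] --> b ->
  u @ \oo --> (a +i* b : R[i]^o).
Proof.
move=> /cvgrPdist_lt ua /cvgrPdist_lt ub; apply/cvgnCP => e e0.
have e20 : 0 < e / 2 by rewrite divr_gt0.
near=> n.
apply: le_lt_trans (normc_le_ReIm _) _.
have -> : complex.Re (a +i* b - u n) = a - complex.Re (u n) by case: (u n).
have -> : complex.Im (a +i* b - u n) = b - complex.Im (u n) by case: (u n).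
rewrite [ltRHS](splitr e) ltrD //; near: n; [exact: ua|exact: ub].
Unshelve. all: by end_near. Qed.

Lemma normc_lim_le (u : nat -> R[i]^o) (l : R[i]^o) (B : R) :
  u @ \oo --> l -> (forall n, normc (u n) <= B) -> normc l <= B.
Proof.
move=> /cvgnCP ul uB; apply/ler_addgt0Pl => e e0.
have [N _ /(_ N (leqnn N)) uN] := ul e e0.
rewrite -[l](subrK (u N)) (le_trans (normc_triangle _ _)) // lerD ?uB //.
exact: ltW.
Qed.

(** Completeness of the complex numbers, through the real and imaginary parts. *)
Lemma is_cvg_series_normc u :
  cvgn (series (fun n => normc (u n))) -> cvgn (series (u : nat -> R[i]^o)).
Proof.
move=> cu.
have cv (v : nat -> R) : (forall n, `|v n| <= normc (u n)) -> cvgn (series v).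
  move=> vu; apply: normed_cvg; apply: series_le_cvg cu => n; [exact: normr_ge0|exact: normc_ge0|exact: vu].
have cRe := cv (fun n => complex.Re (u n)) (fun n => normc_Re (u n)).
have cIm := cv (fun n => complex.Im (u n)) (fun n => normc_Im (u n)).
apply/cvg_ex; exists (limn (series (fun n => complex.Re (u n))) +i*
                     limn (series (fun n => complex.Im (u n))) : R[i]^o).
apply: cvgnC_ReIm.
  apply: cvg_trans cRe; apply: near_eq_cvg; near=> n.
  by rewrite /series /= (raddf_sum (@complex.Re R : Rcomplex R -> R)).
apply: cvg_trans cIm; apply: near_eq_cvg; near=> n.
by rewrite /series /= (raddf_sum (@complex.Im R : Rcomplex R -> R)).
Unshelve. all: by end_near. Qed.

End ComplexLimits.

(** * Real and complex power series with real coefficients *)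

Section PowerSeries.
Variable R : realType.
Implicit Types (c : nat -> R) (z h : R[i]) (x r : R).

Definition psC_terms c z : nat -> R[i]^o := fun n => (c n)%:C * z ^+ n.

Definition psC c z : R[i]^o := limn (series (psC_terms c z)).

Definition ps c x : R := limn (pseries c x).

Definition abs_cvg c r := cvgn (series (fun n => `|c n| * r ^+ n)).

Lemma normc_psC_terms c z n : normc (psC_terms c z n) = `|c n| * normc z ^+ n.
Proof. by rewrite normcM normc_real normcX. Qed.

Lemma psC_cvg c z : abs_cvg c (normc z) ->
  series (psC_terms c z) @ \oo --> psC c z.
Proof.
move=> cz; apply: is_cvg_series_normc.
by under eq_fun do rewrite normc_psC_terms.
Qed.

Lemma ps_cvg c x : abs_cvg c `|x| -> pseries c x @ \oo --> ps c x.
Proof.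
move=> cx; apply: normed_cvg; rewrite /normed_series_of /=.
by under eq_fun do rewrite normrM normrX.
Qed.

Lemma psC_real c x : abs_cvg c `|x| -> psC c x%:C = (ps c x)%:C.
Proof.
move=> cx; apply: cvg_lim => //.
rewrite [X in X @ _ --> _](_ : _ = (fun n => (pseries c x n)%:C)).
  exact/cvgnC_real/ps_cvg.
apply/funext => n; rewrite /series /= rmorph_sum /=.
by apply: eq_bigr => i _; rewrite /psC_terms rmorphM rmorphXn.
Qed.

Lemma partial_sum_le_ps c r n : (forall n, 0 <= c n) -> 0 <= r -> abs_cvg c r ->
  \sum_(0 <= i < n) c i * r ^+ i <= ps c r.
Proof.
move=> c0 r0 cr.
have := @ps_cvg c r; rewrite ger0_norm // => /(_ cr) cv.
apply: (nondecreasing_cvgn_le _ (cvgP _ cv) n).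
by apply: nondecreasing_series => i _ _; rewrite mulr_ge0 ?exprn_ge0.
Qed.

Lemma normc_psC_le c r z : normc z <= r -> abs_cvg c r ->
  normc (psC c z) <= ps (fun n => `|c n|) r.
Proof.
move=> zr cr.
have r0 : 0 <= r by exact: le_trans (normc_ge0 z) zr.
have le_n n : `|c n| * normc z ^+ n <= `|c n| * r ^+ n.
  by rewrite ler_wpM2l // lerXn2r // nnegrE ?normc_ge0.
have cz : abs_cvg c (normc z).
  apply: series_le_cvg le_n cr => n; rewrite mulr_ge0 ?exprn_ge0 ?normc_ge0 //.
have cr' : abs_cvg (fun n => `|c n|) r.
  by rewrite /abs_cvg; under eq_fun do rewrite normr_id.
apply: normc_lim_le (psC_cvg cz) _ => n; rewrite /series /=.
apply: le_trans (normc_sum_le _ _) _.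
apply: le_trans (@partial_sum_le_ps (fun n => `|c n|) r n _ r0 cr') => //.
by apply: ler_sum => i _; rewrite normc_psC_terms.
Qed.

Lemma psN c x : abs_cvg c `|x| -> ps (fun n => - c n) x = - ps c x.
Proof.
move=> cx; apply: cvg_lim => //.
rewrite [X in X @ _ --> _](_ : _ = - pseries c x); first by apply: cvgN; exact: ps_cvg.
apply/funext => n; rewrite /pseries /series /= -[RHS]/(- series _ n) /series /= -sumrN.
by apply: eq_bigr => i _; rewrite mulNr.
Qed.

Lemma abs_cvg_bounded c r s M : 0 <= r -> r < s ->
  (forall n, `|c n| * s ^+ n <= M) -> abs_cvg c r.
Proof.
move=> r0 rs cM.
have s0 : 0 < s by exact: le_lt_trans rs.
have q0 : 0 <= r / s by rewrite divr_ge0 // ltW.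
have M0 : 0 <= M by apply: le_trans (cM 0%N); rewrite mulr_ge0 // exprn_ge0 // ltW.
apply: (@series_le_cvg _ _ (geometric M (r / s))) => [n|n|n|].
- by rewrite mulr_ge0 ?exprn_ge0.
- by rewrite /= mulr_ge0 // exprn_ge0.
- rewrite /= -[in leLHS](divfK (lt0r_neq0 s0) r) exprMn mulrCA mulrC.
  by rewrite ler_wpM2r // exprn_ge0.
- by apply: is_cvg_geometric_series; rewrite ger0_norm // ltr_pdivrMr // mul1r.
Qed.

(** The Cauchy-Hadamard condition of infinite radius of convergence, in a form
    stable under differentiation of the coefficients. *)
Definition entire c := forall r, 0 <= r -> exists M, forall n, `|c n| * r ^+ n <= M.

Lemma entire_abs_cvg c r : entire c -> 0 <= r -> abs_cvg c r.
Proof.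
move=> ec r0; have r1 : r < r + 1 by rewrite ltrDl.
have [|M hM] := ec (r + 1); first by rewrite addr_ge0.
exact: abs_cvg_bounded r0 r1 hM.
Qed.

Lemma entire_diffs c : entire c -> entire (pseries_diffs c).
Proof.
move=> ec r r0.
have [|M hM] := ec (2 * (r + 1)); first by rewrite mulr_ge0 // addr_ge0.
exists M => n; apply: le_trans (hM n.+1); rewrite /pseries_diffs normrM normr_nat.
rewrite -mulrA mulrCA ler_wpM2l // exprMn ler_pM ?exprn_ge0 //.
  by rewrite -natrX ler_nat ltnW // ltn_expl.
rewrite exprS (@le_trans _ _ ((r + 1) ^+ n)) //.
  by rewrite lerXn2r ?nnegrE ?addr_ge0 // lerDl.
by rewrite ler_peMl ?exprn_ge0 ?addr_ge0 // lerDr.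
Qed.

Lemma is_derive_ps c x : entire c -> is_derive x 1 (ps c) (ps (pseries_diffs c) x).
Proof.
move=> ec.
have cv d : entire d -> cvgn (pseries d (`|x| + 1)).
  by move=> ed; apply: ps_cvg; apply: entire_abs_cvg.
apply: (@pseries_snd_diffs R c (`|x| + 1)) => //; do ?exact/cv/entire_diffs.
- exact: cv.
- exact/cv/entire_diffs/entire_diffs.
- by rewrite [ltRHS]ger0_norm ?addr_ge0 // ltrDl.
Qed.

Lemma ps_continuous c : entire c -> continuous (ps c).
Proof.
move=> ec x; apply/differentiable_continuous/derivable1_diffP.
by have [] := is_derive_ps x ec.
Qed.

Lemma ps0 c : ps c 0 = c 0%N.
Proof.
apply: cvg_lim => //; rewrite -cvg_shiftS.
rewrite [X in X @ _ --> _](_ : _ = fun=> c 0%N); first exact: cvg_cst.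
apply/funext => n; rewrite /pseries /series /= big_nat_recl //= expr0 mulr1.
by rewrite big1 ?addr0 // => i _; rewrite exprS mul0r mulr0.
Qed.

Lemma psC0 c : psC c 0 = (c 0%N)%:C.
Proof.
apply: cvg_lim => //; rewrite -cvg_shiftS.
rewrite [X in X @ _ --> _](_ : _ = fun=> (c 0%N)%:C); first exact: cvg_cst.
apply/funext => n; rewrite /series /= big_nat_recl //= /psC_terms expr0 mulr1.
by rewrite big1 ?addr0 // => i _; rewrite exprS mul0r mulr0.
Qed.

(** Second order Taylor remainder of a monomial.  The crude factor (2 r)^n
    avoids binomial coefficients and is harmless for an entire series. *)
Lemma expr_taylor2_le z h r n : 1 <= r -> normc z <= r -> normc (z + h) <= r ->
  normc ((z + h) ^+ n - z ^+ n - h * (n%:R * z ^+ n.-1)) <= normc h ^+ 2 * (2 * r) ^+ n.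
Proof.
move=> r1 zr zhr; have r0 : 0 <= r by rewrite (le_trans _ r1).
elim: n => [|n IH].
  by rewrite !expr0 subrr mul0r mulr0 subr0 normc0 mulr1 sqr_ge0.
have -> : (z + h) ^+ n.+1 - z ^+ n.+1 - h * (n.+1%:R * z ^+ n.+1.-1) =
  (z + h) * ((z + h) ^+ n - z ^+ n - h * (n%:R * z ^+ n.-1)) +
  h ^+ 2 * (n%:R * z ^+ n.-1).
  by case: n {IH} => [|n] /=; rewrite !exprS -?[n.+2%:R]natr1 -?[n.+1%:R]natr1; ring.
apply: le_trans (normc_triangle _ _) _; rewrite (normcM (z + h)) (normcM (h ^+ 2)) normcX.
have h2 : 0 <= normc h ^+ 2 by rewrite sqr_ge0.
have nz : normc (n%:R * z ^+ n.-1) <= 2 ^+ n * r ^+ n.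
  rewrite normcM normcX ler_pM ?normc_ge0 ?exprn_ge0 ?normc_ge0 //.
    by rewrite -[n%:R](rmorph_nat (real_complex R)) normc_real normr_nat -natrX ler_nat ltnW // ltn_expl.
  case: n {IH} => [|n] /=; first by rewrite !expr0.
  rewrite exprS (@le_trans _ _ (r ^+ n)) ?lerXn2r ?nnegrE ?normc_ge0 //.
  by rewrite ler_peMl ?exprn_ge0.
have IH' : normc (z + h) * normc ((z + h) ^+ n - z ^+ n - h * (n%:R * z ^+ n.-1)) <=
   r * (normc h ^+ 2 * (2 * r) ^+ n) by rewrite ler_pM ?normc_ge0.
have nz' : normc h ^+ 2 * normc (n%:R * z ^+ n.-1) <= normc h ^+ 2 * (r * (2 * r) ^+ n).
  rewrite ler_wpM2l // (le_trans nz) // -exprMn ler_peMl // exprn_ge0 // mulr_ge0 //.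
apply: le_trans (lerD IH' nz') _.
by rewrite [(2 * r) ^+ n.+1]exprS le_eqVlt; apply/orP; left; apply/eqP; ring.
Qed.


(** Summing [expr_taylor2_le] against the coefficients gives
    |f(z + h) - f(z) - h f'(z)| <= B |h|^2 for |h| <= 1. *)
Lemma diff_quotient_psC c z : entire c ->
  h^-1 *: (psC c (h + z) - psC c z) @[h --> (0 : R[i]^o)^'] --> psC (pseries_diffs c) z.
Proof.
move=> ec; pose r := normc z + 1.
have r1 : 1 <= r by rewrite lerDr normc_ge0.
have r0 : 0 <= r by rewrite (le_trans _ r1).
have [M hM] := ec (4 * r) ltac:(by rewrite mulr_ge0).
have cv : abs_cvg c (2 * r).
  by apply: entire_abs_cvg => //; rewrite mulr_ge0.
pose B := ps (fun n => `|c n|) (2 * r).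
have cvz d (w : R[i]) : entire d -> series (psC_terms d w) @ \oo --> psC d w.
  by move=> ed; apply: psC_cvg; apply: entire_abs_cvg => //; exact: normc_ge0.
have quad h : normc h <= 1 ->
    normc (psC c (h + z) - psC c z - h * psC (pseries_diffs c) z) <= normc h ^+ 2 * B.
  move=> h1.
  have cvh : (fun n => series (psC_terms c (h + z)) n.+1 - series (psC_terms c z) n.+1
      - h * series (psC_terms (pseries_diffs c) z) n) @ \oo -->
      (psC c (h + z) - psC c z - h * psC (pseries_diffs c) z : R[i]^o).
    apply: cvgB.
      by apply: cvgB; [have := cvz c (h + z) ec|have := cvz c z ec]; rewrite -cvg_shiftS.
    by apply: cvgMr; apply: cvz; exact: entire_diffs.
  apply: normc_lim_le cvh _ => n.
  have -> : series (psC_terms c (h + z)) n.+1 - series (psC_terms c z) n.+1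
      - h * series (psC_terms (pseries_diffs c) z) n =
      \sum_(0 <= i < n.+1) (c i)%:C * ((z + h) ^+ i - z ^+ i - h * (i%:R * z ^+ i.-1)).
    rewrite /series /= -sumrB [in RHS]big_nat_recl // [in LHS]big_nat_recl //=.
    rewrite /psC_terms !expr0 !subrr !mul0r mulr0 subr0 mulr0 !add0r mulr_sumr -sumrB.
    apply: eq_bigr => i _; rewrite /pseries_diffs rmorphM rmorph_nat [h + z]addrC /=; ring.
  apply: le_trans (normc_sum_le _ _) _.
  have cB : abs_cvg (fun n => `|c n|) (2 * r).
    by rewrite /abs_cvg; under eq_fun do rewrite normr_id.
  have nB := @partial_sum_le_ps (fun n => `|c n|) (2 * r) n.+1 _ _ cB.
  apply: (@le_trans _ _ (normc h ^+ 2 * \sum_(0 <= i < n.+1) `|c i| * (2 * r) ^+ i)).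
    rewrite mulr_sumr; apply: ler_sum => i _; rewrite normcM normc_real [leRHS]mulrCA.
    rewrite ler_wpM2l // expr_taylor2_le // ?lerDl //.
    by rewrite (le_trans (normc_triangle _ _)) // lerD2l.
  by rewrite ler_wpM2l ?sqr_ge0 // nB // mulr_ge0.
apply/cvgrPdist_lt => -[e e']; rewrite ltcE /= => /andP[/eqP -> /= e0].
have B0 : 0 <= B.
  have := quad 1; rewrite normc1 lexx expr1n (mul1r B) => /(_ isT).
  exact: le_trans (normc_ge0 _).
pose d := Num.min 1 (e / (B + 1)).
have d0 : 0 < d by rewrite lt_min ltr01 divr_gt0 // ltr_pwDr.
near=> h.
have h0 : h != 0 by near: h; exact: (@nbhs_dnbhs_neq R[i]^o 0).
have : `|h| < d%:C.
  near: h; apply: (@dnbhs0_lt _ R[i]^o); by rewrite (ltcR 0).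
rewrite normCE ltcR lt_min => /andP[h1 hB].
rewrite normCE -complexr0 ltcR.
have nh0 : 0 < normc h by rewrite lt_neqAle eq_sym normc_eq0 h0 normc_ge0.
rewrite normcB.
have -> : h^-1 *: (psC c (h + z) - psC c z) - psC (pseries_diffs c) z =
   h^-1 * (psC c (h + z) - psC c z - h * psC (pseries_diffs c) z).
  by rewrite [in RHS]mulrBr mulKf.
rewrite normcM normcV mulrC ltr_pdivrMr //.
apply: le_lt_trans (quad h (ltW h1)) _.
rewrite expr2 -mulrA mulrC ltr_pM2r //.
apply: (@le_lt_trans _ _ (normc h * (B + 1))); first by rewrite ler_wpM2l ?normc_ge0 // lerDl.
by rewrite -ltr_pdivlMr // ltr_pwDr.
Unshelve. all: by end_near. Qed.

Lemma derive1_psC c : entire c -> derive1 (psC c) = psC (pseries_diffs c).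
Proof.
by move=> ec; apply/funext => z; apply: cvg_lim => //; exact: diff_quotient_psC.
Qed.

Lemma derive1n_psC c n : entire c ->
  entire (iter n (@pseries_diffs R) c) /\
  derive1n n (psC c) = psC (iter n (@pseries_diffs R) c).
Proof.
move=> ec; elim: n => [|n [en IH]] //; split; first exact: entire_diffs.
by rewrite derive1nS IH derive1_psC.
Qed.

Lemma iter_diffs0 c n : iter n (@pseries_diffs R) c 0%N = n`!%:R * c n.
Proof.
rewrite -[n in c n]addn0.
have -> : n`!%:R = (n + 0)`!%:R / 0`!%:R :> R by rewrite addn0 divr1.
elim: n 0%N => [|n IH] m; first by rewrite add0n divff ?mul1r // pnatr_eq0 -lt0n fact_gt0.
rewrite iterS /pseries_diffs IH -addSnnS [m.+1`!]factS natrM; field.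
by rewrite -[1]/(1%:R) -natrD !pnatr_eq0 -lt0n fact_gt0.
Qed.

Lemma taylor_coef_psC c n : entire c -> taylor_coef (psC c) n = (c n)%:C.
Proof.
move=> ec; rewrite /taylor_coef (proj2 (derive1n_psC n ec)) psC0 iter_diffs0.
by rewrite rmorphM rmorph_nat mulrAC divff ?mul1r // pnatr_eq0 -lt0n fact_gt0.
Qed.

Lemma conv_radius_psC c : entire c -> conv_radius (psC c) = +oo%E.
Proof.
move=> ec; apply/eqyP => r r0; apply: ereal_sup_ubound; exists r => //.
split; first exact: ltW.
under eq_fun do rewrite taylor_coef_psC // normc_real.
exact/entire_abs_cvg/ltW.
Qed.

End PowerSeries.

(** * Product of power series *)

Lemma sum_convolution (K : comPzRingType) (a b : nat -> K) n :
  \sum_(0 <= k < n) \sum_(i < k.+1) a i * b (k - i)%N =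
  \sum_(0 <= j < n) b j * \sum_(0 <= i < n - j) a i.
Proof.
elim: n => [|n IH]; first by rewrite !big_geq.
rewrite big_nat_recr //= IH [in RHS]big_nat_recr //= subSnn big_nat1.
have -> : \sum_(0 <= j < n) b j * \sum_(0 <= i < n.+1 - j) a i =
    \sum_(0 <= j < n) b j * \sum_(0 <= i < n - j) a i + \sum_(0 <= j < n) b j * a (n - j)%N.
  rewrite -big_split; apply: eq_big_nat => j /andP[_ jn] /=.
  by rewrite subSn 1?ltnW // big_nat_recr //= mulrDr.
rewrite -addrA; congr (_ + _).
transitivity (\sum_(0 <= j < n.+1) b j * a (n - j)%N); last by rewrite big_nat_recr //= subnn.
rewrite big_mkord [RHS](reindex_inj rev_ord_inj) /=.
by apply: eq_bigr => i _; rewrite subSS subKn ?leq_ord // mulrC.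
Qed.

Section CauchyProduct.
Variable R : realType.
Implicit Types (c d e : nat -> R) (z : R[i]).

(** A geometric sum of ratio at most 1/2 is at most twice its first term. *)
Lemma psC_tail_le c z q M : 0 <= q <= 2^-1 -> (forall n, normc (psC_terms c z n) <= M * q ^+ n) ->
  abs_cvg c (normc z) -> forall n,
  normc (psC c z - \sum_(0 <= i < n) psC_terms c z i) <= 2 * M * q ^+ n.
Proof.
move=> /andP[q0 q1] cM cz n.
have M0 : 0 <= M by have := cM 0%N; rewrite mulr1; apply: le_trans; exact: normc_ge0.
have cv : (fun m => series (psC_terms c z) (m + n)%N - \sum_(0 <= i < n) psC_terms c z i) @ \oo -->
    (psC c z - \sum_(0 <= i < n) psC_terms c z i : R[i]^o).
  apply: cvgB; last exact: cvg_cst.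
  by rewrite (cvg_shiftn n); exact: psC_cvg.
apply: normc_lim_le cv _ => m.
rewrite /series /= (big_cat_nat (n := n)) ?leq_addl //= addrAC subrr add0r.
suff : normc (\sum_(n <= i < m + n) psC_terms c z i) <= 2 * M * (q ^+ n - q ^+ (m + n)).
  move=> h; apply: le_trans h _; rewrite ler_wpM2l ?mulr_ge0 // gerBl.
  by rewrite exprn_ge0.
elim: m => [|m IH]; first by rewrite add0n big_geq // normc0 subrr mulr0.
rewrite addSn big_nat_recr ?leq_addl //=.
apply: le_trans (normc_triangle _ _) _; apply: le_trans (lerD IH (cM _)) _.
have : 0 <= q ^+ (m + n) by rewrite exprn_ge0.
rewrite exprS; move: (q ^+ (m + n)) (q ^+ n) => x y x0.
have : q * (M * x) <= 2^-1 * (M * x) by rewrite ler_wpM2r // mulr_ge0.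
lra.
Qed.

(** Cauchy product.  By [sum_convolution], the partial sum of the product
    differs from (sum of c) times (partial sum of d) by the sum of the
    d_j z^j (C - C_(n-j)), where C_m are the partial sums of c and C their
    limit.  As c is entire, the tails C - C_m decay like (t/2)^m, while the
    terms d_j z^j are bounded by a multiple of t^j for the same t < 1: the
    difference is of order t^n. *)
Lemma psC_cauchy c d e z s N : entire c -> normc z < s ->
  (forall n, `|d n| * s ^+ n <= N) ->
  (forall k, \sum_(i < k.+1) c i * d (k - i)%N = e k) ->
  psC c z * psC d z = psC e z.
Proof.
move=> ec zs dN cde.
have z0 := normc_ge0 z.
have s0 : 0 < s by exact: le_lt_trans zs.
have N0 : 0 <= N by apply: le_trans (dN 0%N); rewrite mulr1.
have [M cM] := ec (2 * s) ltac:(by rewrite mulr_ge0 // ltW).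
have M0 : 0 <= M by apply: le_trans (cM 0%N); rewrite mulr1.
pose t := normc z / s.
have t0 : 0 <= t by rewrite divr_ge0 // ltW.
have t1 : t < 1 by rewrite ltr_pdivrMr // mul1r.
have zE : normc z = t * s by rewrite divfK // lt0r_neq0.
have cz : abs_cvg c (normc z) by exact: entire_abs_cvg.
have dz : abs_cvg d (normc z) by exact: abs_cvg_bounded zs dN.
have dT n : normc (psC_terms d z n) <= N * t ^+ n.
  rewrite normc_psC_terms zE exprMn mulrCA mulrC ler_wpM2r ?exprn_ge0 //.
have cT n : normc (psC_terms c z n) <= M * (t / 2) ^+ n.
  rewrite normc_psC_terms (_ : normc z = t / 2 * (2 * s)); last by rewrite zE; field.
  by rewrite exprMn mulrCA mulrC ler_wpM2r ?exprn_ge0 // divr_ge0.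
have q : 0 <= t / 2 <= 2^-1 by apply/andP; split; lra.
have tail := psC_tail_le q cT cz.
apply/esym/cvg_lim => //.
apply: (@cvg_sub0 _ _ _ _ _ (series (psC_terms e z))
  (fun n => psC c z * series (psC_terms d z) n)); last first.
  by apply: cvgMr; exact: psC_cvg.
have tN : (fun n => 2 * M * N * t ^+ n) @ \oo --> 0.
  rewrite -(mulr0 (2 * M * N)); apply: cvgMr; apply: cvg_expr; by rewrite ger0_norm.
apply/cvgnCP => eps eps0.
move/cvgrPdist_lt : tN => /(_ eps eps0); apply: filterS => n.
rewrite sub0r normrN sub0r; apply: le_lt_trans; apply: le_trans (ler_norm _).
rewrite -normcN opprK.
have -> : (series (psC_terms e z) - (fun n => psC c z * series (psC_terms d z) n)) n =
   - \sum_(0 <= j < n) psC_terms d z j * (psC c z - \sum_(0 <= i < n - j) psC_terms c z i).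
  rewrite /= -[LHS]/(series (psC_terms e z) n - psC c z * series (psC_terms d z) n).
  rewrite /series /=.
  have -> : \sum_(0 <= k < n) psC_terms e z k =
      \sum_(0 <= k < n) \sum_(i < k.+1) psC_terms c z i * psC_terms d z (k - i)%N.
    apply: eq_bigr => k _; rewrite /psC_terms -cde rmorph_sum mulr_suml /=.
    apply: eq_bigr => i _; rewrite rmorphM mulrACA -exprD subnKC // -ltnS //.
  rewrite sum_convolution mulr_sumr -sumrB -sumrN.
  by apply: eq_bigr => j _; ring.
rewrite normcN; apply: le_trans (normc_sum_le _ _) _.
apply: (@le_trans _ _ (\sum_(0 <= j < n) 2 * M * N * t ^+ n * 2^-1 ^+ (n - j))).
  apply: ler_sum_nat => j /andP[_ jn]; rewrite normcM.
  apply: le_trans (ler_pM (normc_ge0 _) (normc_ge0 _) (dT j) (tail (n - j)%N)) _.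
  rewrite -[in t ^+ n](subnKC (ltnW jn)) exprD [(t / 2) ^+ _]exprMn.
  by rewrite le_eqVlt; apply/orP; left; apply/eqP; move: (2^-1 ^+ _) => x; ring.
rewrite -mulr_sumr ler_piMr // ?mulr_ge0 ?exprn_ge0 //.
suff -> : \sum_(0 <= j < n) 2^-1 ^+ (n - j) = 1 - 2^-1 ^+ n :> R by rewrite gerBl exprn_ge0.
elim: n => [|n IH]; first by rewrite big_geq // subrr.
rewrite big_nat_recl //= subn0; under eq_bigr do rewrite subSS.
by rewrite IH exprS; field.
Qed.

End CauchyProduct.

(** * The coefficients of the Lommel function *)

Lemma pochhammerS (K : numFieldType) (a : K) n :
  pochhammer a n.+1 = pochhammer a n * (a + n%:R).
Proof. by rewrite /pochhammer big_ord_recr. Qed.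

Lemma pochhammer_gt0 (K : realFieldType) (a : K) n : 0 < a -> 0 < pochhammer a n.
Proof. by move=> a0; apply: prodr_gt0 => i _; rewrite ltr_wpDr. Qed.

Lemma pochhammer_real (R : realType) (a : R) n :
  pochhammer a%:C n = (pochhammer a n)%:C.
Proof.
rewrite /pochhammer rmorph_prod; apply: eq_bigr => i _.
by rewrite rmorphD rmorph_nat.
Qed.

Lemma pochhammer1 (K : numFieldType) n : pochhammer (1 : K) n = n`!%:R.
Proof.
elim: n => [|n IH]; first by rewrite /pochhammer big_ord0.
by rewrite pochhammerS IH factS mulnC natrM nat1r.
Qed.

(** Legendre's duplication formula. *)
Lemma pochhammer_double (K : numFieldType) (a : K) n :
  pochhammer a (2 * n) = 4 ^+ n * (pochhammer (a / 2) n * pochhammer ((a + 1) / 2) n).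
Proof.
elim: n => [|n IH]; first by rewrite /pochhammer !big_ord0 !mulr1.
by rewrite mulnS !addSn add0n !pochhammerS IH exprS -[(2 * n).+1%:R]natr1 natrM; field.
Qed.

Section LommelCoefficients.
Variable R : realType.
Implicit Types (a x : R) (z : R[i]).

Definition lommel_coef a n : R := (-1) ^+ n / pochhammer a (2 * n).

(** By duplication, the parameters a/2 and (a + 1)/2 of the hypergeometric
    series merge into the symbol (a)_(2n), and the numerator symbol (1)_n
    cancels against n!. *)
Lemma hyp1F2_term a n : 0 < a ->
  pochhammer 1 n / (pochhammer (a / 2) n * pochhammer ((a + 1) / 2) n) / n`!%:R =
  4 ^+ n * (-1) ^+ n * lommel_coef a n.
Proof.
move=> a0; have P0 : pochhammer (a / 2) n != 0 by rewrite lt0r_neq0 // pochhammer_gt0 // divr_gt0.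
have Q0 : pochhammer ((a + 1) / 2) n != 0.
  by rewrite lt0r_neq0 // pochhammer_gt0 // divr_gt0 // addr_gt0.
have n0 : n`!%:R != 0 :> R by rewrite pnatr_eq0 -lt0n fact_gt0.
have four0 : 4 ^+ n != 0 :> R by rewrite expf_neq0.
have ss : (-1) ^+ n * (-1) ^+ n = 1 :> R by rewrite -exprMn mulrNN mulr1 expr1n.
rewrite pochhammer1 /lommel_coef pochhammer_double -mulrA mulrACA.
transitivity ((pochhammer (a / 2) n * pochhammer ((a + 1) / 2) n)^-1 * ((-1) ^+ n * (-1) ^+ n)).
  by rewrite ss; field; rewrite n0 P0 Q0.
by move: ((-1) ^+ n) ss => s _; field; rewrite four0 P0 Q0.
Qed.

Lemma lommel_coefS a n : 0 < a -> lommel_coef a n.+1 =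
  - (lommel_coef a n / ((a + (2 * n)%:R) * (a + (2 * n)%:R + 1))).
Proof.
move=> a0; rewrite /lommel_coef mulnS !addSn add0n !pochhammerS exprS.
rewrite -[(2 * n).+1%:R]natr1 addrA.
have n0 : 0 <= n%:R :> R by [].
field; apply/and3P; split; apply: lt0r_neq0; [lra|lra|exact: pochhammer_gt0].
Qed.

Lemma lommel_coef_norm a n : 0 < a -> `|lommel_coef a n| = (pochhammer a (2 * n))^-1.
Proof.
move=> a0; rewrite /lommel_coef normrM normrX normrN1 expr1n mul1r.
by rewrite ger0_norm // invr_ge0 ltW // pochhammer_gt0.
Qed.

Lemma pochhammer_ge_expr a n : 1 <= a -> n`!%:R <= pochhammer a n.
Proof.
move=> a1; elim: n => [|n IH]; first by rewrite /pochhammer big_ord0.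
rewrite pochhammerS factS mulnC natrM ler_pM // -nat1r lerD2r //.
Qed.

Lemma entire_lommel_coef a : 1 <= a -> entire (lommel_coef a).
Proof.
move=> a1 r r0; have a0 : 0 < a by exact: lt_le_trans a1.
exists (expR r) => n; rewrite lommel_coef_norm // mulrC.
apply: (@le_trans _ _ (r ^+ n / n`!%:R)).
  rewrite ler_wpM2l ?exprn_ge0 // lef_pV2 ?posrE ?pochhammer_gt0 ?ltr0n ?fact_gt0 //.
  apply: le_trans (pochhammer_ge_expr _ a1); rewrite ler_nat.
  by rewrite leq_fact ?leq_pmull.
case: n => [|n]; first by rewrite expr0 divr1 -expR0 ler_expR.
by apply: le_trans (expR_ge1Dxn n r0); rewrite lerDr.
Qed.

End LommelCoefficients.

(** * The Lommel functions as power series *)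

Section HypergeometricForms.
Variable R : realType.
Implicit Types (mu a x : R) (z : R[i]).

Definition mulX_coef (c : nat -> R) n : R := if n is m.+1 then c m else 0.

Lemma entire_mulX c : entire c -> entire (mulX_coef c).
Proof.
move=> ec r r0; have [M hM] := ec r r0.
exists (r * M) => -[|n] /=; first by rewrite normr0 mul0r mulr_ge0 // (le_trans _ (hM 0%N)) // mulr_ge0.
by rewrite exprS mulrCA ler_wpM2l.
Qed.

Lemma psC_mulX c z : entire c -> psC (mulX_coef c) z = z * psC c z.
Proof.
move=> ec; apply: cvg_lim => //; rewrite -cvg_shiftS.
rewrite [X in X @ _ --> _](_ : _ = fun n => z * series (psC_terms c z) n).
  by apply: cvgMr; apply: psC_cvg; apply: entire_abs_cvg => //; exact: normc_ge0.
apply/funext => n; rewrite /series /= big_nat_recl //= /psC_terms /= mul0r add0r mulr_sumr.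
by apply: eq_bigr => i _; rewrite exprS mulrCA.
Qed.

Lemma ps_mulX c x : entire c -> ps (mulX_coef c) x = x * ps c x.
Proof.
move=> ec; apply: cvg_lim => //; rewrite -cvg_shiftS.
rewrite [X in X @ _ --> _](_ : _ = fun n => x * pseries c x n).
  by apply: cvgMr; apply: ps_cvg; exact: entire_abs_cvg.
apply/funext => n; rewrite /pseries /series /= big_nat_recl //= mul0r add0r mulr_sumr.
by apply: eq_bigr => i _; rewrite exprS mulrCA.
Qed.

Lemma hyp1F2_lommel a x : 0 < a ->
  hyp1F2 1 (a / 2) ((a + 1) / 2) (- (x / 4)) = ps (lommel_coef a) x.
Proof.
move=> a0; rewrite /hyp1F2 /ps /pseries; congr (limn (series _)); apply/funext => n.
rewrite mulrAC exprNn exprMn exprVn hyp1F2_term //.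
have four0 : 4 ^+ n != 0 :> R by rewrite expf_neq0.
have ss : (-1) ^+ n * (-1) ^+ n = 1 :> R by rewrite -exprMn mulrNN mulr1 expr1n.
transitivity (((-1) ^+ n * (-1) ^+ n) * lommel_coef a n * x ^+ n); last by rewrite ss mul1r.
by move: ((-1) ^+ n) => s; field.
Qed.

Lemma hyp1F2_lommelC a z : 0 < a ->
  hyp1F2 1 (a / 2)%:C ((a + 1) / 2)%:C (- (z / 4)) = psC (lommel_coef a) z.
Proof.
move=> a0; rewrite /hyp1F2 /psC; congr (limn (series _)); apply/funext => n.
have e1 : pochhammer (1 : R[i]) n = (pochhammer 1 n)%:C by rewrite -pochhammer_real rmorph1.
rewrite mulrAC exprNn exprMn exprVn e1 !pochhammer_real.
rewrite -[n`!%:R](rmorph_nat (real_complex R)) -rmorphM -fmorphV -rmorphM -fmorphV -rmorphM /=.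
rewrite hyp1F2_term // /psC_terms; move: (lommel_coef a n) => c.
have four0 : 4 ^+ n != 0 :> R[i] by rewrite expf_neq0.
have ss : (-1) ^+ n * (-1) ^+ n = 1 :> R[i] by rewrite -exprMn mulrNN mulr1 expr1n.
rewrite !rmorphM !rmorphXn rmorphN rmorph1 rmorph_nat /=.
transitivity (((-1) ^+ n * (-1) ^+ n) * c%:C * z ^+ n); last by rewrite ss mul1r.
by move: ((-1) ^+ n) => s; field.
Qed.

Lemma lommel_hE mu : -1 < mu ->
  @lommel_h R mu = psC (mulX_coef (lommel_coef (mu + 2))).
Proof.
move=> mu1; apply/funext => z.
have a1 : 1 <= mu + 2 by lra.
rewrite psC_mulX; last exact: entire_lommel_coef.
rewrite /lommel_h -hyp1F2_lommelC; last by lra.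
by have -> : mu + 2 + 1 = mu + 3 by ring.
Qed.

Lemma lommel_sE mu x : -1 < mu ->
  lommel_s (mu - 2^-1) 2^-1 x =
  x `^ (mu + 2^-1) / (mu * (mu + 1)) * ps (lommel_coef (mu + 2)) (x ^+ 2).
Proof.
move=> mu1; rewrite /lommel_s -hyp1F2_lommel; last by lra.
congr (_ `^ _ / (_ * _) * hyp1F2 _ (_ / _) (_ / _) _); lra.
Qed.

End HypergeometricForms.

(** * Nonnegative expansion of the logarithmic derivative of h' *)

Section KeyEstimate.
Variables (R : realType) (a : R).
Hypothesis a13 : 1 < a < 3.
Implicit Types (x r : R) (z : R[i]) (n : nat).

Let a1 : 1 <= a. Proof. by have := a13; lra. Qed.
Let a0 : 0 < a. Proof. by have := a13; lra. Qed.

(** Coefficients of g = h', where h(z) = z F(z). *)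
Definition dlommel_coef n : R := n.+1%:R * lommel_coef a n.

Local Notation g := dlommel_coef.

Lemma dlommel_coefE : pseries_diffs (mulX_coef (lommel_coef a)) = g.
Proof. by []. Qed.

Lemma entire_dlommel_coef : entire g.
Proof. by rewrite -dlommel_coefE; apply/entire_diffs/entire_mulX/entire_lommel_coef. Qed.

Let sigma := a * (a + 1).
Let sigma0 : 0 < sigma. Proof. by rewrite mulr_gt0 // addr_gt0. Qed.

(** The absolute values of the coefficients of g in the variable z / (a (a + 1)),
    which makes the first ones 1 and 2. *)
Let A n := n.+1%:R * sigma ^+ n / pochhammer a (2 * n).

Let coefA n : g n = (-1) ^+ n * A n / sigma ^+ n.
Proof.
have s0 : sigma ^+ n != 0 by rewrite expf_neq0 // lt0r_neq0.
have p0 : pochhammer a (2 * n) != 0 by rewrite lt0r_neq0 // pochhammer_gt0.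
rewrite /g /A /lommel_coef; move: ((-1) ^+ n) => s; field; by rewrite s0.
Qed.

Let A_ge0 n : 0 <= A n.
Proof. by rewrite /A !mulr_ge0 ?invr_ge0 ?exprn_ge0 // ltW // pochhammer_gt0. Qed.

Let AS n : (n.+1%:R * (a + 2 * n%:R) * (a + 2 * n%:R + 1)) * A n.+1 =
   n.+2%:R * sigma * A n.
Proof.
have p0 : pochhammer a (2 * n) != 0 by rewrite lt0r_neq0 // pochhammer_gt0.
have n0 : 0 <= n%:R :> R by [].
have h := a0.
rewrite /A mulnS !addSn add0n !pochhammerS exprS -[(2 * n).+1%:R]natr1; field.
rewrite p0 /=; apply/andP; split; apply: lt0r_neq0; lra.
Qed.

Let A0 : A 0 = 1.
Proof. by rewrite /A /pochhammer big_ord0 mulr1 divr1. Qed.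

Let A1 : A 1 = 2.
Proof.
apply: (mulfI (lt0r_neq0 sigma0)); rewrite mulrC [RHS]mulrC -[RHS]mulr1 -[X in _ = _ * X]A0 -AS.
by rewrite /sigma !mulr0 !addr0; ring.
Qed.


(** The ratio of consecutive coefficients is largest at the end point a = 3,
    where the inequality is an equality: a / (a + 2n) <= 3 / (3 + 2n) and
    (a + 1) / (a + 1 + 2n) <= 4 / (4 + 2n). *)
Let A_ratio n : (n.+1 * (2 * n + 3))%:R * A n.+1 <= 6 * A n.
Proof.
have n0 : 0 <= n%:R :> R by [].
have /andP[ha ha'] := a13.
pose D := n.+1%:R * (a + 2 * n%:R) * (a + 2 * n%:R + 1).
have D0 : 0 < D by rewrite !mulr_gt0 //; lra.
rewrite -(ler_pM2l D0) mulrCA AS !natrM natrD natrM.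
have -> : D * (6 * A n) = n.+1%:R * (6 * (a + 2 * n%:R) * (a + 2 * n%:R + 1)) * A n.
  by rewrite /D; ring.
rewrite [leLHS](_ : _ = n.+1%:R * ((2 * n%:R + 3) * n.+2%:R * sigma) * A n); last by ring.
rewrite ler_wpM2r ?A_ge0 // ler_wpM2l //.
have -> : n.+2%:R = n%:R + 2 :> R by rewrite -addn2 natrD.
rewrite /sigma; move: (n%:R : R) n0 => t t0.
have h1 : a * (2 * t + 3) <= 3 * (a + 2 * t) by nra.
have h2 : (a + 1) * (2 * t + 4) <= 4 * (a + 2 * t + 1) by nra.
have : (a * (2 * t + 3)) * ((a + 1) * (2 * t + 4)) <=
   (3 * (a + 2 * t)) * (4 * (a + 2 * t + 1)).
  by apply: ler_pM => //; rewrite mulr_ge0; lra.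
lra.
Qed.

Let A2_val : A 2 * ((a + 2) * (a + 3)) = 3 * sigma.
Proof. by have := AS 1; rewrite A1; lra. Qed.

Let A3_val : A 3 * (3 * (a + 4) * (a + 5)) = 4 * sigma * A 2.
Proof. by have := AS 2; lra. Qed.


Let A2_le : A 2 <= 6 / 5.
Proof. by have := A_ratio 1; rewrite A1; lra. Qed.

(** A_3 / A_2^2 is a multiple of (a + 2) (a + 3) / ((a + 4) (a + 5)), which
    increases with a.  The bound is needed only when A_2 may be close to or
    above 1; for a <= 2 the bound on A_2 is enough. *)
Let A3_ge : 2 <= a -> 40 / 189 * A 2 ^+ 2 <= A 3.
Proof.
move=> a2; have := A3_val; have := A2_val; have := A_ge0 2.
move: (A 2) (A 3) => x y x0 hx hy.
have D0 : 0 < 3 * (a + 4) * (a + 5) by rewrite !mulr_gt0 //; lra.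
rewrite -(ler_pM2r D0) hy.
have -> : 4 * sigma * x = 4 / 3 * x ^+ 2 * ((a + 2) * (a + 3)) by rewrite expr2; nra.
have -> : 40 / 189 * x ^+ 2 * (3 * (a + 4) * (a + 5)) = x ^+ 2 * (40 / 63 * ((a + 4) * (a + 5))) by field.
have -> : 4 / 3 * x ^+ 2 * ((a + 2) * (a + 3)) = x ^+ 2 * (4 / 3 * ((a + 2) * (a + 3))) by field.
by rewrite ler_wpM2l ?sqr_ge0 //; nra.
Qed.

Let A4_le : A 4 <= A 3 / 6.
Proof. by have := A_ratio 3; lra. Qed.

Let A2_le_small : a <= 2 -> A 2 <= 9 / 10.
Proof.
move=> a2; have := a1; have := A2_val; rewrite /sigma; move: (A 2) => x hx ha.
have D0 : 0 < (a + 2) * (a + 3) by rewrite !mulr_gt0 //; lra.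
by rewrite -(ler_pM2r D0) hx; nra.
Qed.

Let A23 : 0 <= 4 * (1 - A 2) + 3 * A 3.
Proof.
have := A2_le; have := A_ge0 3; have := A_ge0 2.
case: (lerP a 2) => [/A2_le_small|/ltW/A3_ge]; move: (A 2) (A 3) => x y; nra.
Qed.

Let A234 : 0 <= 8 - 10 * A 2 + 2 * A 2 ^+ 2 + 5 * A 3 - 4 * A 4.
Proof.
have := A2_le; have := A_ge0 3; have := A_ge0 2; have := A4_le.
case: (lerP a 2) => [/A2_le_small|/ltW/A3_ge]; move: (A 2) (A 3) (A 4) => x y w; nra.
Qed.


(** The constant 39/100 is a compromise: the estimate in
    [convexity_equation_neg] needs it large, the one in [normc_dlommel_sub1]
    needs it small, and both are worst near a = 3. *)
Definition zero_free_radius : R := 39 / 100 * (a * (a + 1)).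

Local Notation Z0 := zero_free_radius.

Lemma zero_free_radius_gt0 : 0 < Z0.
Proof. by rewrite /Z0 mulr_gt0 //; have := sigma0; rewrite /sigma; lra. Qed.

Let gC z : abs_cvg g (normc z).
Proof. by apply: entire_abs_cvg; [exact: entire_dlommel_coef|exact: normc_ge0]. Qed.

(** Here S is the sum of the series of -g'/g.  The disk |z| <= Z0 lies inside its
    disk of convergence, and nonnegative coefficients make S(|z|) a bound of
    |g'(z) / g(z)|, attained on the positive axis. *)
Lemma log_derivative_majorant : exists S : R -> R,
  (forall r, 0 <= r <= Z0 -> ps g r * S r = - ps (pseries_diffs g) r) /\
  (forall z, normc z <= Z0 ->
     normc (psC (pseries_diffs g) z) <= normc (psC g z) * S (normc z)).
Proof.
have [T hT] := @series_quotient_exists R (fun n => (-1) ^+ n * A n)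
  (fun k => (-1) ^+ k * (k.+1%:R * A k.+1)) ltac:(by rewrite /= expr0 mul1r A0).
have T0 := log_derivative_ge0 A0 A1 A_ge0 A_ratio A23 A234 hT.
have T2 := log_derivative_le A0 A1 A_ge0 A_ratio A23 A234 hT.
(* Back from the normalized variable to z; the shift of the exponent comes from
   the derivative in -g'/g. *)
pose t n := T n / sigma ^+ n.+1.
have t0 n : 0 <= t n by rewrite divr_ge0 // exprn_ge0 // ltW // sigma0.
have tb n : `|- t n| * (sigma / 2) ^+ n <= 2 / sigma.
  rewrite normrN ger0_norm // /t [(sigma / 2) ^+ n]exprMn exprVn [sigma ^+ n.+1]exprS.
  have s0 : sigma ^+ n != 0 by rewrite expf_neq0 // lt0r_neq0 // sigma0.
  have -> : T n / (sigma * sigma ^+ n) * (sigma ^+ n / 2 ^+ n) = T n / 2 ^+ n / sigma.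
    by field; rewrite s0 expf_neq0 //= lt0r_neq0 // sigma0.
  rewrite ler_wpM2r ?invr_ge0 ?(ltW sigma0) // ler_pdivrMr ?exprn_gt0 //.
  by rewrite -exprS.
have conv k : \sum_(i < k.+1) g i * - t (k - i)%N = pseries_diffs g k.
  rewrite /pseries_diffs coefA.
  have sk : sigma ^+ k.+1 != 0 by rewrite expf_neq0 // lt0r_neq0 // sigma0.
  transitivity (- (\sum_(i < k.+1) ((-1) ^+ i * A i) * T (k - i)%N) / sigma ^+ k.+1).
    rewrite -sumrN mulr_suml; apply: eq_bigr => i _.
    have ik : (i <= k)%N by rewrite -ltnS.
    have e : sigma ^+ k.+1 = sigma ^+ i * sigma ^+ (k - i).+1 by rewrite -exprD addnS subnKC.
    rewrite coefA /t e invfM; move: (sigma ^- _) (sigma ^- _) => u v; ring.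
  by rewrite hT [(-1) ^+ k.+1]exprS; move: (sigma ^- _) ((-1) ^+ k) => u v; ring.
have Zs : Z0 < sigma / 2 by have := sigma0; rewrite /zero_free_radius -/sigma; lra.
have tc r : 0 <= r <= Z0 -> abs_cvg (fun n => - t n) r.
  move=> /andP[r0 rZ]; exact: (abs_cvg_bounded r0 (le_lt_trans rZ Zs) tb).
have prod z : normc z <= Z0 -> psC g z * psC (fun n => - t n) z = psC (pseries_diffs g) z.
  move=> zZ; exact: (psC_cauchy entire_dlommel_coef (le_lt_trans zZ Zs) tb conv).
exists (ps t); split=> [r /andP[r0 rZ]|z zZ].
  have nr : `|r| = r by rewrite ger0_norm.
  have /complexI e : (ps g r * ps (fun n => - t n) r)%:C = (ps (pseries_diffs g) r)%:C.
    rewrite rmorphM /= -!psC_real ?nr.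
    - by apply: prod; rewrite normc_real nr.
    - by apply: entire_abs_cvg => //; exact/entire_diffs/entire_dlommel_coef.
    - by apply: tc; rewrite r0.
    - by apply: entire_abs_cvg => //; exact: entire_dlommel_coef.
  rewrite -e -mulrN -psN ?nr; last by apply: tc; rewrite r0.
  by congr (_ * ps _ _); apply/funext => n; rewrite opprK.
rewrite -prod // normcM ler_wpM2l ?normc_ge0 //.
have := @normc_psC_le _ (fun n => - t n) (normc z) z (lexx _).
rewrite (_ : (fun n => `|- t n|) = t); last by apply/funext => n; rewrite normrN ger0_norm.
by apply; apply: tc; rewrite normc_ge0.
Qed.

Let A_geo n : A n.+2 <= 6 / 5 * (2 / 7) ^+ n.
Proof.
elim: n => [|n IH]; first by rewrite expr0 mulr1 A2_le.
rewrite exprS.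
have h : A n.+3 <= 2 / 7 * A n.+2.
  have := A_ratio n.+2; have := A_ge0 n.+3.
  rewrite natrM natrD natrM (_ : n.+3%:R = n%:R + 3); last by rewrite -natrD addn3.
  rewrite (_ : n.+2%:R = n%:R + 2); last by rewrite -natrD addn2.
  have : 0 <= n%:R :> R by [].
  move: (n%:R : R) (A n.+3) (A n.+2) => t y x t0 y0 h.
  have ty : 0 <= t * y by rewrite mulr_ge0.
  have tty : 0 <= t * (t * y) by rewrite mulr_ge0.
  lra.
lra.
Qed.

Let majorant_term n : `|g n| * Z0 ^+ n = A n * (39 / 100) ^+ n.
Proof.
have s0 : sigma ^+ n != 0 by rewrite expf_neq0 // lt0r_neq0 // sigma0.
rewrite coefA -mulrA normrM normrX normrN1 expr1n mul1r ger0_norm; last first.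
  by rewrite divr_ge0 // exprn_ge0 // ltW // sigma0.
rewrite (_ : Z0 ^+ n = (39 / 100) ^+ n * sigma ^+ n); last by rewrite -exprMn.
by move: (sigma ^+ n) s0 (A n) ((39 / 100) ^+ n) => u u0 v w; field; rewrite u0.
Qed.

(** At radius Z0 the second coefficient of g contributes at most 78/100, and the
    following ones at most 183/1000 times the sum of a geometric series of
    ratio 1/8. *)
Lemma normc_dlommel_sub1 z : normc z <= Z0 -> normc (psC g z - 1) <= 99 / 100.
Proof.
move=> zZ; have z0 := normc_ge0 z; have Zp := zero_free_radius_gt0.
have cv : (fun n => series (psC_terms g z) (n + 2)%N - (1 : R[i]^o)) @ \oo --> (psC g z - (1 : R[i]^o)).
  have h1 : (fun n => series (psC_terms g z) (n + 2)%N) @ \oo --> psC g z.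
    by rewrite (cvg_shiftn 2); exact/psC_cvg/gC.
  exact: (cvgB h1 (cvg_cst (1 : R[i]^o))).
apply: normc_lim_le cv _ => n.
have term_le i : normc (psC_terms g z i) <= A i * (39 / 100) ^+ i.
  by rewrite normc_psC_terms -majorant_term ler_wpM2l // lerXn2r // nnegrE // ltW.
have -> : series (psC_terms g z) (n + 2)%N - 1 =
    psC_terms g z 1 + \sum_(0 <= i < n) psC_terms g z i.+2.
  rewrite addn2 /series /= big_nat_recl //= big_nat_recl //= [psC_terms g z 0]/psC_terms.
  by rewrite expr0 mulr1 /dlommel_coef /lommel_coef /pochhammer big_ord0 divr1 mulr1 addrAC subrr add0r.
apply: le_trans (normc_triangle _ _) _.
have h1 := term_le 1; rewrite A1 expr1 in h1.
suff : normc (\sum_(0 <= i < n) psC_terms g z i.+2) <= 21 / 100 * (1 - (1 / 8) ^+ n).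
  by have : 0 <= (1 / 8 : R) ^+ n by []; lra.
elim: n => [|n IH]; first by rewrite big_geq // normc0 expr0 subrr mulr0.
rewrite big_nat_recr //=; apply: le_trans (normc_triangle _ _) _.
apply: le_trans (lerD IH (term_le _)) _.
have w0 : 0 <= (39 / 100 : R) ^+ n.+2 by [].
have h2 : A n.+2 * (39 / 100) ^+ n.+2 <= 183 / 1000 * (1 / 8) ^+ n.
  apply: le_trans (ler_wpM2r w0 (A_geo n)) _.
  have -> : 6 / 5 * (2 / 7) ^+ n * (39 / 100) ^+ n.+2 =
     6 / 5 * (39 / 100 * (39 / 100)) * (2 / 7 * (39 / 100)) ^+ n :> R.
    rewrite [(2 / 7 * (39 / 100)) ^+ n]exprMn 2![_ ^+ _.+1]exprS.
    move: ((2 / 7) ^+ n) ((39 / 100) ^+ n) => u v; ring.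
  apply: ler_pM; rewrite ?exprn_ge0 //; first by lra.
  by rewrite lerXn2r ?nnegrE //; lra.
have x0 : 0 <= (1 / 8 : R) ^+ n by [].
rewrite [(1 / 8) ^+ n.+1]exprS; move: ((1 / 8) ^+ n) (A n.+2 * _) x0 h2 => x y; lra.
Qed.

Lemma dlommel_neq0 z : normc z <= Z0 -> psC g z != 0.
Proof.
move=> /normc_dlommel_sub1; apply: contraTneq => ->.
by rewrite sub0r normcN normc1 -ltNge; lra.
Qed.

Lemma dlommel_gt0 r : 0 <= r <= Z0 -> 0 < ps g r.
Proof.
move=> /andP[r0 rZ]; have := @normc_dlommel_sub1 r%:C.
rewrite normc_real ger0_norm // => /(_ rZ).
rewrite psC_real; last by apply: entire_abs_cvg => //; exact: entire_dlommel_coef.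
rewrite -[1]/((1 : R)%:C) -rmorphB normc_real ler_norml => /andP[]; lra.
Qed.

Lemma ps_diffs_mulX c x : entire c ->
  ps (pseries_diffs (mulX_coef c)) x = ps c x + x * ps (pseries_diffs c) x.
Proof.
move=> ec; have := is_derive_ps x (entire_mulX ec).
have -> : ps (mulX_coef c) = (fun y => y * ps c y) by apply/funext => y; rewrite ps_mulX.
have h1 := is_derive_ps x ec.
have h2 : is_derive x 1 (fun y : R => y * ps c y) (ps c x + x * ps (pseries_diffs c) x).
  apply: is_derive_eq; rewrite /GRing.scale /=; ring.
by move=> h3; rewrite -(@derive_val _ _ _ _ _ _ _ h3) (@derive_val _ _ _ _ _ _ _ h2).
Qed.

(** The left side is the value at Z0 of the alternating series with
    coefficients (n + 1) A_n w^n, w = 39/100, which is at most its partial sum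
    1 - 4 w + 3 A_2 w^2; here A_2 <= 6/5. *)
Lemma convexity_equation_neg : ps g Z0 + Z0 * ps (pseries_diffs g) Z0 < 0.
Proof.
have eg := entire_dlommel_coef; have Zp := zero_free_radius_gt0.
rewrite -ps_diffs_mulX //.
have e2 : entire (pseries_diffs (mulX_coef g)) by exact/entire_diffs/entire_mulX.
apply: (@le_lt_trans _ _ (- (1 / 100))); last by lra.
have cv := @ps_cvg _ _ Z0 (entire_abs_cvg e2 (normr_ge0 _)).
have cv4 : (fun n => pseries (pseries_diffs (mulX_coef g)) Z0 (n + 4)%N) @ \oo -->
    ps (pseries_diffs (mulX_coef g)) Z0 by rewrite (cvg_shiftn 4).
rewrite -(cvg_lim _ cv4) //; apply: limr_le; first exact: cvgP cv4.
near=> n.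
pose w : R := 39 / 100.
have termE i : pseries_diffs (mulX_coef g) i * Z0 ^+ i = (-1) ^+ i * (i.+1%:R * (A i * w ^+ i)).
  have s0 : sigma ^+ i != 0 by rewrite expf_neq0 // lt0r_neq0 // sigma0.
  rewrite /pseries_diffs /= coefA (_ : Z0 ^+ i = w ^+ i * sigma ^+ i); last by rewrite -exprMn.
  by move: (sigma ^+ i) s0 (A i) (w ^+ i) ((-1) ^+ i) => u u0 v q e; field; rewrite u0.
rewrite /pseries /series /= addn4.
under eq_bigr do rewrite termE.
(* Partial sums with at least four terms: the first three are kept, the others
   form an alternating sum of negative sign. *)
rewrite big_nat_recl // big_nat_recl // big_nat_recl //= A0 A1.
pose u i := i.+4%:R * (A i.+3 * w ^+ i.+3).
have -> : \sum_(0 <= i < n.+1) (-1) ^+ i.+3 * (i.+4%:R * (A i.+3 * w ^+ i.+3)) =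
    - \sum_(i < n.+1) (-1) ^+ i * u i.
  rewrite big_mkord -sumrN; apply: eq_bigr => i _; rewrite /u.
  by move: (_ * (_ * _)) => v; rewrite !exprS; ring.
have /andP[S0 _] : 0 <= \sum_(i < n.+1) (-1) ^+ i * u i <= u 0%N.
  have w0 : 0 <= w by rewrite /w; lra.
  have u0 i : 0 <= u i.
    rewrite /u; apply: mulr_ge0 => //; apply: mulr_ge0; first exact: A_ge0.
    exact: exprn_ge0.
  apply: alternating_sum_bounds => i _; first exact: u0.
  rewrite /u [w ^+ i.+4]exprS.
  have -> : i.+1.+4%:R * (A i.+4 * (w * w ^+ i.+3)) = w * i.+1.+4%:R * A i.+4 * w ^+ i.+3 by ring.
  rewrite mulrA ler_wpM2r ?exprn_ge0 //.
  have := A_ratio i.+3; rewrite natrM natrD natrM -mulrA mulrCA.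
  have -> : i.+1.+4%:R = i%:R + 5 :> R by rewrite -natrD addnS addn4.
  have -> : i.+4%:R = i%:R + 4 :> R by rewrite -natrD addn4.
  have -> : i.+3%:R = i%:R + 3 :> R by rewrite -natrD addn3.
  have := A_ge0 i.+4; have := A_ge0 i.+3; rewrite /w.
  have : 0 <= i%:R :> R by [].
  move: (i%:R : R) (A i.+3) (A i.+4) => t x y t0 x0 y0 h.
  have ty : 0 <= t * y by rewrite mulr_ge0.
  have tx : 0 <= t * x by rewrite mulr_ge0.
  have tty : 0 <= t * (t * y) by rewrite mulr_ge0.
  lra.
have := A2_le; rewrite expr0 expr1 /w; move: S0; set S := \sum_(_ < _) _; move: (A 2) => x; lra.
Unshelve. all: by end_near. Qed.

End KeyEstimate.

(** * Existence of a positive zero *)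

Section FirstZeroExists.
Variable R : realType.
Implicit Types (a x y b : R) (c : nat -> R).

Lemma ps_lin c d s t x : entire c -> entire d ->
  ps (fun n => s * c n + t * d n) x = s * ps c x + t * ps d x.
Proof.
move=> ec ed; apply: cvg_lim => //.
rewrite [X in X @ _ --> _](_ : _ = fun n => s * pseries c x n + t * pseries d x n).
  by apply: cvgD; apply: cvgMr; apply: ps_cvg; exact: entire_abs_cvg.
apply/funext => n; rewrite /pseries /series /= !mulr_sumr -big_split.
by apply: eq_bigr => i _ /=; rewrite mulrDl !mulrA.
Qed.

Lemma entire_lin c d s t : entire c -> entire d -> entire (fun n => s * c n + t * d n).
Proof.
move=> ec ed r r0; have [M hM] := ec r r0; have [N hN] := ed r r0.
exists (`|s| * M + `|t| * N) => n.
apply: (@le_trans _ _ (`|s| * (`|c n| * r ^+ n) + `|t| * (`|d n| * r ^+ n))).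
  rewrite !mulrA -mulrDl ler_wpM2r ?exprn_ge0 // -!normrM; exact: ler_normD.
by rewrite lerD // ler_wpM2l.
Qed.

(** On y^n the Euler operator s + 2 y d/dy has eigenvalue s + 2 n; for y = x^2
    it is s + x d/dx. *)
Lemma euler_coefE c s : (fun n => (s + 2 * n%:R) * c n) =
  (fun n => s * c n + 2 * mulX_coef (pseries_diffs c) n).
Proof.
apply/funext => -[|n] /=; first by rewrite !mulr0 !addr0.
by rewrite /pseries_diffs mulrDl mulrA.
Qed.

Lemma ps_euler c s y : entire c ->
  ps (fun n => (s + 2 * n%:R) * c n) y = s * ps c y + 2 * y * ps (pseries_diffs c) y.
Proof.
move=> ec; rewrite euler_coefE ps_lin //; last exact/entire_mulX/entire_diffs.
by rewrite ps_mulX ?mulrA //; exact: entire_diffs.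
Qed.

Lemma entire_euler c s : entire c -> entire (fun n => (s + 2 * n%:R) * c n).
Proof.
by move=> ec; rewrite euler_coefE; apply: entire_lin => //; exact/entire_mulX/entire_diffs.
Qed.

Lemma is_derive_ps_sqr c x : entire c ->
  is_derive x 1 (fun x => ps c (x ^+ 2)) (2 * x * ps (pseries_diffs c) (x ^+ 2)).
Proof.
move=> ec; have h := is_derive_ps (x ^+ 2) ec.
have e : (fun x => ps c (x ^+ 2)) = ps c \o (fun x => x ^+ 2) by [].
rewrite e; apply: is_derive_eq; rewrite /GRing.scale /=; ring.
Qed.

Section Wronskian.
Variable a : R.
Hypothesis a1 : 1 < a.

Let f := lommel_coef a.
Let ef : entire f. Proof. exact/entire_lommel_coef/ltW. Qed.
Let e n : R := (a - 1 + 2 * n%:R) * f n.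
Let ee : entire e. Proof. exact: entire_euler. Qed.

Let E1 y : (a - 1) * ps f y + 2 * y * ps (pseries_diffs f) y = ps e y.
Proof. by rewrite -ps_euler. Qed.

(** With [E1], this factors into two steps of first order the differential
    equation Y'' + Y = (a - 1) (a - 2) x^(a-3) of Y = x^(a-1) F(x^2); here y
    stands for x^2. *)
Let E2 y : (a - 2) * ps e y + 2 * y * ps (pseries_diffs e) y =
  (a - 1) * (a - 2) - y * ps f y.
Proof.
pose one (n : nat) : R := (n == 0%N)%:R.
have eone : entire one.
  move=> r r0; exists 1 => -[|n]; rewrite /one /= ?normr1 ?normr0 ?mul0r //.
  by rewrite expr0 mulr1.
have one1 : ps one y = 1.
  apply: cvg_lim => //; rewrite -cvg_shiftS.
  rewrite [X in X @ _ --> _](_ : _ = fun=> 1); first exact: cvg_cst.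
  apply/funext => n; rewrite /pseries /series /= big_nat_recl //= expr0 mulr1.
  by rewrite big1 ?addr0 // => i _; rewrite mul0r.
have -> : (a - 1) * (a - 2) - y * ps f y =
    (a - 1) * (a - 2) * ps one y + (-1) * ps (mulX_coef f) y.
  by rewrite one1 ps_mulX //; ring.
rewrite -ps_euler // -ps_lin //; last exact: entire_mulX.
congr (ps _ y); apply/funext => -[|n].
  rewrite /e /f /one /lommel_coef /pochhammer muln0 big_ord0 divr1 expr0 /= !mulr0 !addr0 !mulr1; ring.
rewrite /e /f /= /one /= lommel_coefS; last by apply: lt_trans a1.
have n0 : 0 <= n%:R :> R by [].
have a10 := a1.
rewrite -[n.+1%:R]natr1 natrM; field.
by apply/andP; split; apply: lt0r_neq0; lra.
Qed.

(** The expression Y' sin x - Y cos x for Y = x^(a-1) F(x^2), since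
    Y' = x^(a-2) e(x^2) by [E1]. *)
Definition wronskian x := x `^ (a - 2) * ps e (x ^+ 2) * sin x - x `^ (a - 1) * ps f (x ^+ 2) * cos x.

Lemma powR_S x s : 0 < x -> x `^ (s + 1) = x * x `^ s.
Proof.
move=> x0; rewrite powRD ?powRr1 ?(ltW x0) 1?mulrC //.
by rewrite (gt_eqF x0) implybT.
Qed.

Lemma is_derive_wronskian x : 0 < x ->
  is_derive x 1 wronskian ((a - 1) * (a - 2) * x `^ (a - 3) * sin x).
Proof.
move=> x0.
have he := is_derive_ps_sqr x ee; have hf := is_derive_ps_sqr x ef.
have h2 := is_derive1_powR (a - 2) x0; have h1 := is_derive1_powR (a - 1) x0.
apply: is_derive_eq; rewrite /GRing.scale /=.
rewrite (_ : a - 2 - 1 = a - 3); last by ring.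
rewrite (_ : a - 1 - 1 = a - 2); last by ring.
rewrite (_ : a - 1 = a - 2 + 1) ?powR_S //; last by ring.
rewrite (_ : a - 2 = a - 3 + 1) ?powR_S //; last by ring.
have := E1 (x ^+ 2); have := E2 (x ^+ 2).
move: (ps e _) (ps (pseries_diffs e) _) (ps f _) (ps (pseries_diffs f) _) => q q' p p' hq hp.
move: (x `^ (a - 3)) => P.
transitivity (x * P * cos x * (q - ((a - 1) * p + 2 * x ^+ 2 * p')) +
  sin x * P * (((a - 2) * q + 2 * x ^+ 2 * q') + x ^+ 2 * p)); first by ring.
rewrite hp hq; ring.
Qed.

Lemma sinc_cvg1 : (sin x / x : R) @[x --> 0^'+] --> (1 : R).
Proof.
apply: cvg_dnbhs_at_right.
have [d dE] := is_derive_sin (0 : R); rewrite cos0 in dE; rewrite -dE.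
apply: cvg_trans d; apply: near_eq_cvg; near=> h.
by rewrite /= addr0 sin0 subr0 /GRing.scale /= mulr1 mulrC.
Unshelve. all: by end_near. Qed.

Lemma wronskian_cvg0 : wronskian x @[x --> 0^'+] --> 0.
Proof.
have sq0 : (x ^+ 2 : R) @[x --> 0^'+] --> (0 : R).
  apply: cvg_at_right_filter; rewrite -[X in _ --> X](expr0n _ 2); exact: exprn_continuous.
have cps c : entire c -> ps c (x ^+ 2) @[x --> 0^'+] --> ps c 0.
  by move=> ec; apply: (cvg_comp _ _ sq0); exact: ps_continuous.
have ccos : (cos x : R) @[x --> 0^'+] --> cos 0.
  by apply: cvg_at_right_filter; exact: continuous_cos.
have lim : x `^ (a - 1) * (ps e (x ^+ 2) * (sin x / x) - ps f (x ^+ 2) * cos x) @[x --> 0^'+] -->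
    0 * (ps e 0 * 1 - ps f 0 * cos 0).
  apply: cvgM; first by apply: powR_cvg0; rewrite subr_gt0.
  by apply: cvgB; apply: cvgM; [exact: cps|exact: sinc_cvg1|exact: cps|exact: ccos].
rewrite mul0r in lim; apply: cvg_trans lim; apply: near_eq_cvg; near=> x.
have x0 : 0 < x by near: x; exact: nbhs_right_gt.
rewrite /wronskian (_ : a - 1 = a - 2 + 1) ?powR_S //; last by ring.
by field; rewrite lt0r_neq0.
Unshelve. all: by end_near. Qed.

(** Monotonicity on (0, b] of s (W + k cos), where W is the Wronskian, which
    tends to s k at 0.  The term k cos allows to subtract a constant from the
    factor x^(a-3) in the derivative of W; the sign s lets the same statement
    serve for a decreasing W. *)
Lemma wronskian_mono s k b : 0 < b ->
  (forall x, 0 < x < b -> 0 <= s * (((a - 1) * (a - 2) * x `^ (a - 3) - k) * sin x)) ->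
  s * k <= s * (wronskian b + k * cos b).
Proof.
move=> b0 hs; pose V x := s * (wronskian x + k * cos x).
have dV x : 0 < x -> is_derive x 1 V
    (s * (((a - 1) * (a - 2) * x `^ (a - 3) - k) * sin x)).
  move=> x0; have := is_derive_wronskian x0 => h.
  by apply: is_derive_eq; rewrite /GRing.scale /=; ring.
have cV : {within `]0, b], continuous V}.
  apply: derivable_within_continuous => x; rewrite in_itv /= => /andP[x0 _].
  by have [] := dV x x0.
have mono x : 0 < x <= b -> V x <= V b.
  move=> /andP[x0 xb]; apply: (ger0_derive1_le_oc _ _ cV) => //.
  - by move=> y; rewrite in_itv /= => /andP[y0 _]; have [] := dV y y0.
  - move=> y; rewrite in_itv /= => /andP[y0 yb]; rewrite derive1E.
    by have [_ ->] := dV y y0; apply: hs; rewrite y0.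
  - by rewrite in_itv /= x0.
  - by rewrite in_itv /= b0 lexx.
have limV : V x @[x --> 0^'+] --> s * (0 + k * cos 0).
  apply: cvgMr; apply: cvgD; first exact: wronskian_cvg0.
  by apply: cvgMr; apply: cvg_at_right_filter; exact: continuous_cos.
have <- : lim (V x @[x --> 0^'+]) = s * k by rewrite (cvg_lim _ limV) // cos0 mulr1 add0r.
apply: limr_le; first exact: cvgP limV.
near=> x; apply: mono; apply/andP; split; near: x.
  exact: nbhs_right_gt.
exact: nbhs_right_le.
Unshelve. all: by end_near. Qed.

(** At a zero b of sin, the Wronskian is - b^(a-1) F(b^2) cos b.  If a < 2, it
    decreases on (0, pi], so b = pi.  If a >= 2, the function x^(a-3) is
    nonincreasing, so (x^(a-3) - pi^(a-3)) sin x is nonnegative on the whole of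
    (0, 2 pi), and comparison with the constant pi^(a-3) gives b = 2 pi. *)
Lemma lommel_nonpos : a < 3 -> exists2 b, 0 < b & ps f (b ^+ 2) <= 0.
Proof.
move=> a3; have pi0 := pi_gt0 R.
case: (lerP 2 a) => [a2|a2].
  exists (pi *+ 2); first by rewrite mulrn_wgt0.
  pose k := (a - 1) * (a - 2) * pi `^ (a - 3).
  have k0 : 0 <= (a - 1) * (a - 2) by rewrite mulr_ge0 //; lra.
  have powle x y : 0 < x -> x <= y -> y `^ (a - 3) <= x `^ (a - 3).
    move=> x0 xy; have y0 := lt_le_trans x0 xy.
    rewrite -(opprB 3 a) !powRN lef_pV2 ?posrE ?powR_gt0 //.
    by rewrite ge0_ler_powR ?nnegrE ?(ltW x0) ?(ltW y0) //; lra.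
  have /= := @wronskian_mono 1 k (pi *+ 2) ltac:(by rewrite mulrn_wgt0).
  rewrite /wronskian sin2pi cos2pi mulr0 sub0r !mulr1 !mul1r => h.
  have {h} : k <= - ((pi *+ 2) `^ (a - 1) * ps f ((pi *+ 2) ^+ 2)) + k.
    apply: h => x /andP[x0 xpi]; rewrite mul1r /k -mulrBr.
    case: (lerP x pi) => xp.
      rewrite mulr_ge0 ?sin_ge0_pi ?(ltW x0) // mulr_ge0 // subr_ge0; exact: powle.
    have -> : (a - 1) * (a - 2) * (x `^ (a - 3) - pi `^ (a - 3)) * sin x =
        (a - 1) * (a - 2) * (pi `^ (a - 3) - x `^ (a - 3)) * - sin x by ring.
    rewrite mulr_ge0 //.
      rewrite mulr_ge0 // subr_ge0; apply: powle => //; exact: ltW.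
    rewrite -(subrK pi x) sinDpi opprK sin_ge0_pi //.
    by rewrite subr_ge0 (ltW xp) lerBlDr -mulr2n ltW.
  rewrite lerDr oppr_ge0 pmulr_rle0 // powR_gt0 // mulrn_wgt0 //.
exists pi => //.
have /= := @wronskian_mono (- 1) 0 pi pi0.
rewrite /wronskian sinpi cospi !mulr0 sub0r mulrN1 opprK mul0r addr0 mulN1r oppr_ge0.
move=> h; rewrite -(pmulr_rle0 _ (powR_gt0 (a - 1) pi0)); apply: h => x /andP[x0 xpi].
rewrite subr0 mulN1r -mulNr mulr_ge0 ?sin_ge0_pi ?(ltW x0) ?(ltW xpi) //.
have a10 := a1; rewrite -mulNr mulr_ge0 ?powR_ge0 // -mulrN mulr_ge0; lra.
Qed.

End Wronskian.
End FirstZeroExists.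

(** * The equation of the radius *)

Section UniformConvexityEquation.
Variables (R : realType) (mu : R).
Hypothesis mu1 : -1 < mu.
Hypothesis mu0 : mu != 0.
Implicit Types (x t alpha beta : R).

Let a := mu + 2.
Let f := lommel_coef a.
Let p := mu + 2^-1.
Let q n : R := (p + 2 * n%:R) * f n.
Let s := lommel_s (mu - 2^-1) 2^-1.
Let k := (mu * (mu + 1))^-1.

Let ef : entire f. Proof. by apply: entire_lommel_coef; have := mu1; rewrite /a; lra. Qed.
Let eq : entire q. Proof. exact: entire_euler. Qed.
Let eg : entire (dlommel_coef a). Proof. exact: (entire_diffs (entire_mulX ef)). Qed.

Let is_derive_s x : 0 < x -> is_derive x 1 s (k * x `^ (p - 1) * ps q (x ^+ 2)).
Proof.
move=> x0.
have -> : s = (fun x => k * x `^ p * ps f (x ^+ 2)).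
  by apply/funext => y; rewrite /s lommel_sE // mulrAC mulrC mulrA.
have hf := is_derive_ps_sqr x ef; have hp := is_derive1_powR p x0.
apply: is_derive_eq; rewrite /GRing.scale /= ps_euler //.
rewrite {1}(_ : p = p - 1 + 1) ?powR_S //; last by ring.
by ring.
Qed.

Let is_derive_ds x : 0 < x -> is_derive x 1 (derive1 s)
  (k * x `^ (p - 2) * ((p - 1) * ps q (x ^+ 2) + 2 * x ^+ 2 * ps (pseries_diffs q) (x ^+ 2))).
Proof.
move=> x0.
apply: (@near_eq_is_derive _ _ _ (fun x => k * x `^ (p - 1) * ps q (x ^+ 2))) => //.
  near=> y; rewrite derive1E.
  have y0 : 0 < y by near: y; exact: lt_nbhsr.
  by have [_ ->] := is_derive_s y0.
have hq := is_derive_ps_sqr x eq; have hp := is_derive1_powR (p - 1) x0.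
apply: is_derive_eq; rewrite /GRing.scale /=.
rewrite (_ : p - 1 - 1 = p - 2); last by ring.
rewrite {1}(_ : p - 1 = p - 2 + 1) ?powR_S //; last by ring.
by ring.
Unshelve. all: by end_near. Qed.

(** The left side is x^(mu - 1/2) times the derivative of x^(3/2 - mu) s(x),
    which is a multiple of h(x^2). *)
Let denominatorE x : 0 < x -> (3 / 2 - mu) * s x + x * derive1 s x =
  2 * k * x `^ p * ps (dlommel_coef a) (x ^+ 2).
Proof.
move=> x0; rewrite derive1E; have [_ ->] := is_derive_s x0.
rewrite /s lommel_sE // -/k -/p -/f /dlommel_coef -/f ps_euler //.
have -> : ps (fun n => n.+1%:R * f n) (x ^+ 2) =
    ps f (x ^+ 2) + x ^+ 2 * ps (pseries_diffs f) (x ^+ 2).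
  by rewrite -ps_diffs_mulX.
rewrite [x `^ p](_ : _ = x * x `^ (p - 1)); last first.
  by rewrite -powR_S //; congr (_ `^ _); ring.
move: (x `^ (p - 1)) (ps (pseries_diffs f) _) (ps f _) => P F' F; by rewrite /p; field.
Qed.

Let numeratorE x : 0 < x ->
  x * ((5 / 2 - mu) * derive1 s x + x * derive1n 2 s x) = 2 * k * x `^ p *
  (p * ps (dlommel_coef a) (x ^+ 2) + 2 * x ^+ 2 * ps (pseries_diffs (dlommel_coef a)) (x ^+ 2)).
Proof.
move=> x0; rewrite /derive1n /= !derive1E; have [_ ->] := is_derive_s x0.
have [_ ->] := is_derive_ds x0.
rewrite -(ps_euler p (x ^+ 2) eg).
have -> : (fun n => (p + 2 * n%:R) * dlommel_coef a n) = pseries_diffs (mulX_coef q).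
  by apply/funext => n; rewrite /pseries_diffs /= /q /f /dlommel_coef mulrCA.
rewrite ps_diffs_mulX //.
rewrite [x `^ p](_ : _ = x * (x * x `^ (p - 2))); last first.
  rewrite -powR_S // -powR_S //; congr (_ `^ _); ring.
rewrite [x `^ (p - 1)](_ : _ = x * x `^ (p - 2)); last first.
  rewrite -powR_S //; congr (_ `^ _); ring.
rewrite /p; move: (x `^ (p - 2)) (ps (pseries_diffs q) _) (ps q _) => P Q' Q; by field.
Qed.

(** With D the denominator of the equation, its numerator is D', and D is a
    multiple of x^(mu + 1/2) g(x^2); so x D'/D = mu + 1/2 + 2 t g'(t)/g(t) with
    t = x^2. *)
Lemma uc_equationE alpha beta t : 0 < t -> uc_equation mu alpha beta t <->
  ps (dlommel_coef a) t != 0 /\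
  (1 - alpha) * ps (dlommel_coef a) t + (1 + beta) * (t * ps (pseries_diffs (dlommel_coef a)) t) = 0.
Proof.
move=> t0; rewrite /uc_equation.
have x0 : 0 < Num.sqrt t by rewrite sqrtr_gt0.
have x2 : Num.sqrt t ^+ 2 = t by rewrite sqr_sqrtr // ltW.
move: (Num.sqrt t) x0 x2 => x x0 x2.
rewrite -/s denominatorE // x2.
have k0 : k != 0.
  rewrite invr_eq0 mulf_neq0 // lt0r_neq0 //; have := mu1; lra.
have P0 : x `^ p != 0 by rewrite lt0r_neq0 // powR_gt0.
have c0 : 2 * k * x `^ p != 0 by rewrite !mulf_neq0.
set g := ps (dlommel_coef a) t.
rewrite mulf_eq0 negb_or c0 /=.
have N := numeratorE x0; rewrite x2 -/g in N.
set g' := ps (pseries_diffs (dlommel_coef a)) t in N *.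
set M := (5 / 2 - mu) * derive1 s x + x * derive1n 2 s x in N *.
have key : g != 0 -> 4 * (1 - alpha) - (1 + beta) *
    (1 + 2 * mu - 2 * x * (M / (2 * k * x `^ p * g))) =
    4 / g * ((1 - alpha) * g + (1 + beta) * (t * g')).
  move=> g0.
  have -> : 2 * x * (M / (2 * k * x `^ p * g)) = 2 * (p * g + 2 * t * g') / g.
    rewrite -[2 * x * _]mulrA [x * (_ / _)]mulrA N; field.
    by rewrite g0 k0 P0.
  by rewrite /p; field.
split=> -[g0 h]; split=> //.
  move: h; rewrite key // => /eqP; rewrite mulf_eq0 mulf_eq0 invr_eq0 (negbTE g0).
  by rewrite orbF pnatr_eq0 /= => /eqP.
by rewrite key // h mulr0.
Qed.

End UniformConvexityEquation.

(** * The radii *)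

(** The zero is the infimum of the set where phi is nonpositive. *)
Lemma first_zero (R : realType) (phi : R -> R) (b : R) :
  continuous phi -> 0 < phi 0 -> 0 < b -> phi b <= 0 ->
  exists x, [/\ 0 < x <= b, phi x = 0 & forall y, 0 <= y < x -> 0 < phi y].
Proof.
move=> cphi phi0 b0 phib.
pose S := [set y | 0 <= y /\ phi y <= 0].
have Sb : S b by split => //; exact: ltW.
have lbS : lbound S 0 by move=> y [].
have infS : has_inf S by split; [exists b | exists 0].
pose x := inf S.
have x_ge0 : 0 <= x by apply: lb_le_inf => //; exists b.
have xb : x <= b by apply: ge_inf => //; exists 0.
have below y : 0 <= y < x -> 0 < phi y.
  move=> /andP[y0 yx]; rewrite ltNge; apply/negP => phiy.
  by move: yx; rewrite ltNge => /negP; apply; apply: ge_inf; [exists 0|].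
have phix : phi x <= 0.
  rewrite leNgt; apply/negP => phix.
  have /nbhs_ballP[e /= e0 he] : \forall y \near x, 0 < phi y.
    exact: (cvgr_gt (phi x) (cphi x) 0 phix).
  have [y [y0 phiy] yx] := inf_adherent e0 infS.
  have xy : x <= y by apply: ge_inf; [exists 0|].
  move: phiy; rewrite leNgt => /negP; apply; apply: he.
  by rewrite /ball /= distrC ger0_norm ?subr_ge0 // ltrBlDl.
have x0 : 0 < x.
  rewrite lt_neqAle x_ge0 andbT; apply/eqP => x0.
  by move: phix; rewrite -x0 leNgt phi0.
exists x; split=> //; first by rewrite x0.
have [c] : exists2 c, c \in `[0, x]%R & phi c = 0.
  apply: IVT => //; first exact: continuous_subspaceT.
  by rewrite ge_min phix orbT le_max (ltW phi0).
rewrite in_itv /= => /andP[c0 cx] phic.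
move: cx; rewrite le_eqVlt => /predU1P[<- //|cx].
by have := below c; rewrite c0 cx phic ltxx => /(_ isT).
Qed.

Section Radii.
Variables (R : realType) (mu : R).
Hypothesis mu11 : -1 < mu < 1.
Implicit Types (alpha beta r t x : R) (z : R[i]).

Let a := mu + 2.
Let a13 : 1 < a < 3. Proof. by have := mu11; rewrite /a; lra. Qed.
Let mu1 : -1 < mu. Proof. by have /andP[] := mu11. Qed.
Let f := lommel_coef a.
Let g := dlommel_coef a.
Let ef : entire f. Proof. by apply: entire_lommel_coef; have := a13; lra. Qed.
Let eg : entire g. Proof. exact: (entire_diffs (entire_mulX ef)). Qed.
Let Z0 := zero_free_radius a.
Let Z0_gt0 : 0 < Z0. Proof. exact: zero_free_radius_gt0. Qed.

(** g(t) times the margin, at the point t of the positive axis, in the inequality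
    that defines uniform convexity. *)
Definition uc_defect alpha beta t : R :=
  (1 - alpha) * ps g t + (1 + beta) * (t * ps (pseries_diffs g) t).

Lemma derive1_lommel_h : derive1 (lommel_h mu) = psC g.
Proof. by rewrite lommel_hE // derive1_psC //; exact: entire_mulX. Qed.

Lemma derive2_lommel_h : derive1n 2 (lommel_h mu) = psC (pseries_diffs g).
Proof. by rewrite derive1nS derive1n1 derive1_lommel_h derive1_psC. Qed.

Lemma conv_radius_lommel_h : conv_radius (lommel_h mu) = +oo%E.
Proof. by rewrite lommel_hE // conv_radius_psC //; exact: entire_mulX. Qed.

Let psC_at_real c t : entire c -> psC c t%:C = (ps c t)%:C.
Proof. by move=> ec; apply: psC_real; exact: entire_abs_cvg. Qed.

Let g00 : ps g 0 = 1.
Proof.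
by rewrite ps0 /g /dlommel_coef /lommel_coef /pochhammer muln0 big_ord0 expr0 divr1 mulr1.
Qed.

Lemma uc_defect_root alpha beta : 0 <= alpha < 1 -> 0 <= beta ->
  exists r, [/\ 0 < r < Z0, uc_defect alpha beta r = 0 &
    forall t, 0 <= t < r -> 0 < uc_defect alpha beta t].
Proof.
move=> /andP[al0 al1] be0.
have cont : continuous (uc_defect alpha beta).
  move=> x; apply: cvgD; apply: cvgMr; first exact: ps_continuous.
  by apply: cvgM; [exact: cvg_id|apply: ps_continuous; exact: entire_diffs].
have Zneg : uc_defect alpha beta Z0 < 0.
  have := convexity_equation_neg a13; rewrite -/Z0 -/g /uc_defect.
  have : 0 < ps g Z0 by apply: dlommel_gt0 => //; rewrite lexx (ltW Z0_gt0).
  move: (ps g Z0) (Z0 * _) => x y x0 xy.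
  have : (1 + beta) * (x + y) < 0 by rewrite pmulr_rlt0 //; lra.
  have : 0 <= beta * x by rewrite mulr_ge0 // ltW.
  have : 0 <= alpha * x by rewrite mulr_ge0 // ltW.
  lra.
have pos0 : 0 < uc_defect alpha beta 0.
  by rewrite /uc_defect g00 mul0r mulr0 addr0 mulr1 subr_gt0.
have [r [/andP[r0 rZ] rroot rmin]] := first_zero cont pos0 Z0_gt0 (ltW Zneg).
exists r; split=> //; rewrite r0 lt_neqAle rZ andbT.
by apply: contraTneq Zneg => <-; rewrite rroot ltxx.
Qed.

(** The majorant of [log_derivative_majorant] shows that the inequality of
    uniform convexity holds at z as soon as it holds at |z|, hence for |z| < r;
    and it becomes an equality at z = r, so no larger disk is admissible. *)
Lemma uniform_convexity_radius_lommel_h alpha beta r :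
  0 <= alpha < 1 -> 0 <= beta -> 0 < r < Z0 -> uc_defect alpha beta r = 0 ->
  (forall t, 0 <= t < r -> 0 < uc_defect alpha beta t) ->
  uniform_convexity_radius beta alpha (lommel_h mu) = r%:E.
Proof.
move=> /andP[al0 al1] be0 /andP[r0 rZ] rroot rmin.
have [S [Sreal Smaj]] := log_derivative_majorant a13.
have be1 : 0 < 1 + beta by lra.
apply/eqP; rewrite eq_le; apply/andP; split.
  apply: ge_ereal_sup => _ [s [s0 _ hs] <-]; rewrite lee_fin leNgt; apply/negP => rs.
  have [] := hs r%:C; first by rewrite normc_real ger0_norm // ltW.
  rewrite /zf''_f' derive1_lommel_h derive2_lommel_h !psC_at_real //; last exact: entire_diffs.
  have G0 : 0 < ps g r by apply: dlommel_gt0 => //; rewrite !ltW.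
  rewrite -rmorphM -fmorphV -rmorphM normc_real /= => _.
  have -> : r * ps (pseries_diffs g) r / ps g r = - ((1 - alpha) / (1 + beta)).
    move: rroot; rewrite /uc_defect; move: (ps g r) (r * _) G0 => x y x0 h.
    have -> : y = - ((1 - alpha) * x / (1 + beta)).
      apply: (mulfI (lt0r_neq0 be1)); rewrite mulrN mulrCA divff ?lt0r_neq0 // mulr1; lra.
    by field; rewrite !lt0r_neq0.
  have v0 : 0 < (1 - alpha) / (1 + beta) by rewrite divr_gt0 // subr_gt0.
  rewrite normrN gtr0_norm //; have : (1 - alpha) / (1 + beta) * (1 + beta) = 1 - alpha.
    by rewrite divfK // lt0r_neq0.
  by move: (_ / _) => v; lra.
apply: ereal_sup_ubound; exists r => //; split=> //; first by rewrite conv_radius_lommel_h ltry.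
move=> z zr; have z0 := normc_ge0 z.
rewrite /zf''_f' derive1_lommel_h derive2_lommel_h.
have zZ : normc z <= Z0 by exact: ltW (lt_trans zr rZ).
have gz := dlommel_neq0 a13 zZ; split=> //.
set Q := z * _ / _.
have Qle : normc Q <= normc z * S (normc z).
  rewrite /Q normcM normcV normcM ler_pdivrMr; last first.
    by rewrite lt_neqAle eq_sym normc_eq0 gz normc_ge0.
  rewrite -mulrA ler_wpM2l // mulrC; exact: Smaj.
have G0 : 0 < ps g (normc z) by apply: dlommel_gt0 => //; rewrite z0.
have : 0 < uc_defect alpha beta (normc z) by apply: rmin; rewrite z0.
have := Sreal (normc z); rewrite z0 zZ => /(_ isT).
rewrite /uc_defect -/g; move: (ps (pseries_diffs g) _) => G' hG'.
have -> : G' = - (ps g (normc z) * S (normc z)) by rewrite hG' opprK.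
have -> : (1 - alpha) * ps g (normc z) + (1 + beta) * (normc z * - (ps g (normc z) * S (normc z)))
   = ps g (normc z) * ((1 - alpha) - (1 + beta) * (normc z * S (normc z))) by ring.
rewrite pmulr_rgt0 // => h.
have ReQ : - normc Q <= complex.Re Q by have := normc_Re Q; rewrite ler_norml => /andP[].
have := ler_wpM2l (ltW be1) Qle.
have -> : complex.Re (1 + Q) = 1 + complex.Re Q by case: (Q).
lra.
Qed.

Lemma convexity_radiusE : convexity_radius (lommel_h mu) =
  uniform_convexity_radius 0 0 (lommel_h mu).
Proof.
rewrite /convexity_radius /uniform_convexity_radius; congr (ereal_sup (_ @` _)).
apply/seteqP; split=> r [r0 rc hr]; split=> // z zr; have := hr z zr; by rewrite mul0r addr0.
Qed.

Lemma first_zero_lommel_s : mu != 0 -> exists xi,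
  is_smallest_pos (fun t : R => lommel_s (mu - 2^-1) 2^-1 t = 0) xi /\ ps f (xi ^+ 2) = 0.
Proof.
move=> mu0; have /andP[a1 a3] := a13.
have [b b0 hb] := lommel_nonpos a1 a3.
have cont : continuous (fun x => ps f (x ^+ 2)).
  by move=> x; apply: continuous_comp; [exact: exprn_continuous|exact: ps_continuous].
have pos0 : 0 < ps f (0 ^+ 2).
  by rewrite expr0n ps0 /f /lommel_coef /pochhammer muln0 big_ord0 expr0 divr1.
have [xi [/andP[xi0 _] root xmin]] := first_zero cont pos0 b0 hb.
exists xi; split=> //; split=> //; first by rewrite lommel_sE // -/f root mulr0.
move=> y y0; rewrite lommel_sE // => /eqP; rewrite mulf_eq0 mulf_eq0 invr_eq0 mulf_eq0.
rewrite (negbTE mu0) (gt_eqF (powR_gt0 _ y0)) (_ : mu + 1 == 0 = false) /=; last first.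
  by rewrite gt_eqF //; have := mu1; lra.
move=> /eqP Fy; rewrite leNgt; apply/negP => yxi.
by have := xmin y; rewrite (ltW y0) yxi -/f Fy ltxx => /(_ isT).
Qed.

(** Rolle's theorem for h between its zeros 0 and xi^2. *)
Lemma first_zero_derive_lommel_h xi : 0 < xi -> ps f (xi ^+ 2) = 0 -> exists2 delta,
  is_smallest_pos (fun t : R => derive1 (lommel_h mu) t%:C = 0) delta &
  Z0 < delta < xi ^+ 2.
Proof.
move=> xi0 root; have xi2 : 0 < xi ^+ 2 by rewrite exprn_gt0.
pose h x := ps (mulX_coef f) x.
have dh x : is_derive x 1 h (ps g x) by exact: (is_derive_ps x (entire_mulX ef)).
have [c] : exists2 c, c \in `]0, (xi ^+ 2)[%R & is_derive c 1 h 0.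
  apply: Rolle => //.
    by apply: continuous_subspaceT; apply: ps_continuous; exact: entire_mulX.
  by rewrite /h !ps_mulX // root mul0r mulr0.
rewrite in_itv /= => /andP[c0 cxi] hc.
have gc : ps g c = 0.
  by rewrite -(@derive_val _ _ _ _ _ _ _ (dh c)) (@derive_val _ _ _ _ _ _ _ hc).
have [delta [/andP[d0 dc] droot dmin]] :=
  first_zero (ps_continuous eg) ltac:(by rewrite g00) c0 ltac:(by rewrite gc).
exists delta.
  split=> //; first by rewrite derive1_lommel_h psC_at_real // droot.
  move=> y y0; rewrite derive1_lommel_h psC_at_real // => /complexI gy.
  by rewrite leNgt; apply/negP => yd; have := dmin y; rewrite (ltW y0) yd gy ltxx => /(_ isT).
rewrite (le_lt_trans dc cxi) andbT ltNge; apply/negP => dZ.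
by have := @dlommel_gt0 _ _ a13 delta; rewrite (ltW d0) dZ -/g droot ltxx => /(_ isT).
Qed.

End Radii.

Theorem theorem2p3 (R : realType) (mu alpha beta : R)
    (hmu : -1 < mu < 1) (hmu0 : mu != 0) (hmu12 : mu != - 2^-1)
    (halpha : 0 <= alpha < 1) (hbeta : 0 <= beta) :
  exists r rc delta xi : R,
    [/\ uniform_convexity_radius beta alpha (lommel_h mu) = r%:E
        /\ is_smallest_pos (fun t : R => uc_equation mu alpha beta t) r,
        convexity_radius (lommel_h mu) = rc%:E,
        is_smallest_pos
          (fun t : R => derive1 (lommel_h mu) t%:C = 0) delta,
        is_smallest_pos (fun t : R => lommel_s (mu - 2^-1) 2^-1 t = 0) xi &
        [/\ r <= rc, ((alpha, beta) != (0, 0) -> r < rc),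
            rc < delta & delta < xi ^+ 2]].
Proof.
have mu1 : -1 < mu by case/andP: hmu.
have a13 : 1 < mu + 2 < 3 by case/andP: hmu => h1 h2; apply/andP; split; lra.
have h01 : 0 <= (0 : R) < 1 by rewrite lexx ltr01.
have [r [rZ rroot rmin]] := uc_defect_root hmu halpha hbeta.
have [rc [rcZ rcroot rcmin]] := uc_defect_root hmu h01 (lexx 0).
have [xi [xismallest xiroot]] := first_zero_lommel_s hmu hmu0.
have xi0 : 0 < xi by case: xismallest.
have [delta dsmallest /andP[Zd dxi]] := first_zero_derive_lommel_h hmu xi0 xiroot.
have /andP[r0 rZ'] := rZ; have /andP[rc0 rcZ'] := rcZ.
have Grc : 0 < ps (dlommel_coef (mu + 2)) rc by apply: dlommel_gt0; rewrite ?ltW.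
have Drc : uc_defect mu alpha beta rc = - ((alpha + beta) * ps (dlommel_coef (mu + 2)) rc).
  move: rcroot; rewrite /uc_defect subr0 addr0 !mul1r => e.
  have -> : rc * ps (pseries_diffs (dlommel_coef (mu + 2))) rc = - ps (dlommel_coef (mu + 2)) rc by lra.
  ring.
have rrc : r <= rc.
  rewrite leNgt; apply/negP => rcr; have := rmin rc; rewrite (ltW rc0) rcr => /(_ isT).
  rewrite Drc oppr_gt0 pmulr_llt0 //; case/andP: halpha; lra.
exists r, rc, delta, xi; split=> //.
- split; first exact: uniform_convexity_radius_lommel_h rZ rroot rmin.
  split=> //.
    apply/uc_equationE => //; split=> //.
    by rewrite lt0r_neq0 // dlommel_gt0 // !ltW.
  move=> y y0 /(uc_equationE mu1 hmu0 _ _ y0)[_ yroot].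
  rewrite leNgt; apply/negP => yr; have := rmin y; rewrite (ltW y0) yr => /(_ isT).
  by rewrite /uc_defect yroot ltxx.
- rewrite convexity_radiusE; exact: uniform_convexity_radius_lommel_h rcZ rcroot rcmin.
- split=> //; last exact: lt_trans Zd.
  move=> ab0; rewrite lt_neqAle rrc andbT; apply/eqP => rE.
  move: rroot; rewrite rE Drc => /eqP; rewrite oppr_eq0 mulf_eq0 (gt_eqF Grc) orbF => /eqP ab.
  move/negP: ab0; apply; case/andP: halpha => al0 _.
  by apply/eqP; congr pair; lra.
Qed.
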